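(* Let $f\in\mathcal{F}$ and $x\ge 2$. Then for any real number $0<T\le 1$, $$\sum_{n\le x}\frac{f(n)}{n}\ll(\log x)\exp\big(-\mathcal{M}(f;x,T)\big)+\frac1T,$$ where the implied constant is absolute.
   Context: $\mathcal{F}$ is the class of completely multiplicative functions $f:\mathbb{N}\to\mathbb{C}$ with $|f(n)|\le 1$ for all $n$. For $f,h\in\mathcal F$ and $y\ge 2$, $\mathbb{D}(f,h;y):=\left(\sum_{p\le y}\frac{1-\mathrm{Re}(f(p)\overline{h(p)})}{p}\right)^{1/2}$, the sum being over primes $p$. For $T>0$, $\mathcal{M}(f;x,T):=\min_{|t|\le T}\mathbb{D}(f,n^{it};x)^2$, where $n^{it}$ denotes the function $n\mapsto n^{it}$ and $t$ is real. *)

(* Defs.v *)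
From HB Require Import structures.
From mathcomp Require Import all_boot all_order all_algebra.
From mathcomp Require Import all_classical all_reals all_analysis.
From mathcomp Require Import complex.

Set Implicit Arguments.
Unset Strict Implicit.
Unset Printing Implicit Defensive.

Import Order.TTheory GRing.Theory Num.Theory.
Import numFieldTopology.Exports numFieldNormedType.Exports.

Local Open Scope classical_set_scope.
Local Open Scope ring_scope.
Local Open Scope complex_scope.

(* Arithmetic functions are functions on nat whose value at 0 is irrelevant:
   it is neither constrained nor used. *)
Definition completely_multiplicative (R : realType) (f : nat -> R[i]) : Prop :=
  f 1%N = 1 /\
  forall m n : nat, (0 < m)%N -> (0 < n)%N -> f (m * n)%N = f m * f n.

Definition classF (R : realType) (f : nat -> R[i]) : Prop :=
  completely_multiplicative f /\
  forall n : nat, (0 < n)%N -> `|f n| <= 1.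

(* For y >= 0, the naturals n <= y are those with n < (Num.truncn y).+1. *)
Definition pdist (R : realType) (f h : nat -> R[i]) (y : R) : R :=
  Num.sqrt (\sum_(1 <= p < (Num.truncn y).+1 | prime p)
              (1 - complex.Re (f p * (h p)^*)) / p%:R).

(* n^{it} = exp(i t log n) *)
Definition npow_it (R : realType) (t : R) (n : nat) : R[i] :=
  cos (t * ln n%:R) +i* sin (t * ln n%:R).

(* The infimum is a minimum, see minM_attained. *)
Definition minM (R : realType) (f : nat -> R[i]) (x T : R) : R :=
  inf [set pdist f (npow_it t) x ^+ 2 | t in [set t : R | `|t| <= T]].

Lemma continuous_pdist_sqr (R : realType) (f : nat -> R[i]) (x : R) :
  continuous (fun t : R => pdist f (npow_it t) x ^+ 2).
Proof.
move=> t; rewrite /pdist.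
set S := fun s : R => \sum_(1 <= p < (Num.truncn x).+1 | prime p)
  (1 - complex.Re (f p * (npow_it s p)^*)) / p%:R.
suff hS : S @ t --> S t.
  have h := @continuous_cvg _ _ _ (nbhs t) (nbhs_filter t) _ _ _ (@sqrt_continuous R (S t)) hS.
  have hh := @cvgM R _ (nbhs t) (nbhs_filter t) _ _ _ _ h h.
  change ((fun s : R => Num.sqrt (S s) ^+ 2) @ t --> Num.sqrt (S t) ^+ 2).
  by rewrite expr2; under eq_fun do rewrite expr2; exact: hh.
apply: cvg_big => [| p _]; first exact: add_continuous.
case: (f p) => a b; rewrite /npow_it /=.
have cl : (fun s : R => s * ln p%:R) @ t --> t * ln p%:R.
  by apply: cvgM; [exact: cvg_id | exact: cvg_cst].
have cc := @continuous_cvg _ _ _ (nbhs t) (nbhs_filter t) _ _ _ (@continuous_cos R (t * ln p%:R)) cl.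
have cs := @continuous_cvg _ _ _ (nbhs t) (nbhs_filter t) _ _ _ (@continuous_sin R (t * ln p%:R)) cl.
apply: cvgM; last exact: cvg_cst.
apply: cvgB; first exact: cvg_cst.
apply: cvgB; apply: cvgM => //; try exact: cvg_cst.
exact: cvgN.
Qed.

Lemma minM_attained (R : realType) (f : nat -> R[i]) (x T : R) : 0 <= T ->
  exists t0 : R, [/\ `|t0| <= T, minM f x T = pdist f (npow_it t0) x ^+ 2 &
    forall t : R, `|t| <= T ->
      pdist f (npow_it t0) x ^+ 2 <= pdist f (npow_it t) x ^+ 2].
Proof.
move=> T0.
have NTT : - T <= T by rewrite (le_trans _ T0)// oppr_le0.
have [t0 t0T t0min] := EVT_min NTT
  (continuous_subspaceT (@continuous_pdist_sqr R f x)).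
have t0min' t : `|t| <= T ->
    pdist f (npow_it t0) x ^+ 2 <= pdist f (npow_it t) x ^+ 2.
  by rewrite ler_norml => tT; apply: t0min; rewrite in_itv.
have t0T' : `|t0| <= T by move: t0T; rewrite in_itv /= -ler_norml.
exists t0; split => //.
apply/eqP; rewrite /minM eq_le; apply/andP; split.
  apply: ge_inf; last by exists t0.
  by exists (pdist f (npow_it t0) x ^+ 2) => _ [t tT <-]; exact: t0min'.
apply: lb_le_inf; first by exists (pdist f (npow_it t0) x ^+ 2), t0.
by move=> _ [t tT <-]; exact: t0min'.
Qed.

(* Main.v *)
Require Import Defs.
From HB Require Import structures.
From mathcomp Require Import all_boot all_order all_algebra.
From mathcomp Require Import all_classical all_reals all_analysis.
From mathcomp Require Import complex.
From mathcomp Require Import ring lra zify.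

(** Write S(u) for the sum of f(n) / n over n <= u, put L = ln x, and let F be the
Dirichlet series of f restricted to the integers all of whose primes are at most x;
the restriction does not change S(x).

Since ln x = ln n + ln (x / n), the product L S(x) is the sum of
- the sum of (f(n) / n) ln (x / n), which is the integral of S(u) du / u on [1, x], and
- the sum of (f(n) / n) ln n, which, on writing ln n as a sum over the primes dividing
  n, becomes the sum of (ln p / p) f(p) S(x / p) over p <= x, with an error O(L).
The function S changes by O(1) when ln u changes by O(1), and the primes p with ln p in
a unit interval have total weight (ln p) / p at most a constant, by Chebyshev.  So both
parts are O(I + L), with I the integral of |S(u)| du / u on [1, x]: the recursion has
turned a sharp cutoff into an average.

By Cauchy-Schwarz, I^2 is at most L times the integral of |S(u)|^2 du / u, and by
Plancherel the latter is controlled by the integral of |F(1 + 1/L + it)|^2 /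
|1/L + it|^2 dt.  The part |t| <= T contributes at most L times the square of the
maximum M of |F| there.  On |t| > T the denominator is at least T^2, and the mean
square of F, bounded using only |f| <= 1, is small enough to give O(L / T^2).  Hence
S(x) = O(M + 1/T) (log_sum_le_large).  Finally, the Euler product and Mertens' bound
show that |F(1 + 1/L + it)| is of order at most L exp(-D^2), where D is the distance
from f to n^(it) (smooth_dirichlet_bound), so that M is at most of order
L exp(-min D^2).

The argument is carried out with finite sums only.  Logarithms of integers are grouped
into bins of length 1/L, and Plancherel becomes Parseval's identity on a cyclic group
whose order N may be as large as desired (partial_sums_mean_square).  The bins are fine
enough for the discrete transform to agree with F up to O(1) for |t| <= 1
(bin_character), and coarse enough for the squared bin sums to have total O(1)
(sum_sqr_bin_mass), which is all that the frequencies beyond T require.  The conclusion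
of this part is mean_square_bin_sums. *)

Set Implicit Arguments.
Unset Strict Implicit.
Unset Printing Implicit Defensive.

Import Order.TTheory GRing.Theory Num.Theory.
Import ComplexField.Normc.

Local Open Scope ring_scope.
Local Open Scope complex_scope.

(** * The modulus of complex numbers and the unit circle *)

Section Modulus.
Import numFieldTopology.Exports numFieldNormedType.Exports.
Variable R : realType.
Implicit Types (z w : R[i]) (t : R).

Lemma normc_ge0 z : 0 <= normc z.
Proof. by case: z => a b; rewrite /normc sqrtr_ge0. Qed.

Lemma sqr_normcE z : normc z ^+ 2 = complex.Re z ^+ 2 + complex.Im z ^+ 2.
Proof. by case: z => a b; rewrite /normc sqr_sqrtr// addr_ge0 ?sqr_ge0. Qed.

Lemma normc_real (a : R) : normc a%:C = `|a|.
Proof. by rewrite /normc /= expr0n /= addr0 sqrtr_sqr. Qed.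

Lemma normrC z : `|z| = (normc z)%:C.
Proof. by case: z. Qed.

Lemma normc_nat n : normc (n%:R : R[i]) = n%:R.
Proof. by apply: complexI; rewrite -normrC normr_nat rmorph_nat. Qed.

Lemma sqr_normc_conj z : (normc z ^+ 2)%:C = z * z^*.
Proof. by rewrite rmorphXn /= -normCK normrC. Qed.

Lemma normr_Re_le z : `|complex.Re z| <= normc z.
Proof.
rewrite -(@ler_pXn2r _ 2) ?nnegrE ?normc_ge0// real_normK ?num_real// sqr_normcE.
by rewrite lerDl sqr_ge0.
Qed.

Lemma normcB z w : normc (z - w) <= normc z + normc w.
Proof. by rewrite (le_trans (le_normcD _ _))// normcN. Qed.

Lemma normcX z n : normc (z ^+ n) = normc z ^+ n.
Proof.
elim: n => [|n IH]; first by rewrite !expr0 normc1.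
by rewrite !exprS normcM IH.
Qed.

Lemma normc_prod (I : Type) (s : seq I) (P : pred I) (F : I -> R[i]) :
  normc (\prod_(i <- s | P i) F i) = \prod_(i <- s | P i) normc (F i).
Proof. exact: (big_morph _ (@normcM R) (@normc1 R)). Qed.

Lemma normc_sum (I : Type) (s : seq I) (P : pred I) (F : I -> R[i]) :
  normc (\sum_(i <- s | P i) F i) <= \sum_(i <- s | P i) normc (F i).
Proof.
apply: (big_ind2 (fun z (x : R) => normc z <= x)) => //.
  by rewrite normc0.
by move=> z x w y zx wy; rewrite (le_trans (le_normcD _ _))// lerD.
Qed.

Lemma normc_sqrD z w : normc (z + w) ^+ 2 <= 2 * normc z ^+ 2 + 2 * normc w ^+ 2.
Proof.
have := le_normcD z w; have := normc_ge0 (z + w); have := normc_ge0 z.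
have := normc_ge0 w; have := sqr_ge0 (normc z - normc w).
set a := normc (z + w); set b := normc z; set c := normc w.
move=> h1 h2 h3 h4 h5; have : a ^+ 2 <= (b + c) ^+ 2.
  by rewrite ler_pXn2r// ?nnegrE ?addr_ge0.
nra.
Qed.

Definition cis t : R[i] := cos t +i* sin t.

Lemma cis0 : cis 0 = 1.
Proof. by rewrite /cis cos0 sin0. Qed.

Lemma cisD t u : cis (t + u) = cis t * cis u.
Proof.
rewrite /cis cosD sinD; apply/eqP; rewrite eq_complex /=.
by apply/andP; split; apply/eqP; ring.
Qed.

Lemma cisX t n : cis t ^+ n = cis (n%:R * t).
Proof.
elim: n => [|n IH]; first by rewrite expr0 mul0r cis0.
by rewrite exprS IH -cisD; congr cis; rewrite -natr1; ring.
Qed.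

Lemma conj_cis t : (cis t)^*%R = cis (- t).
Proof. by change ((cis t)^*%R) with (conjc (cis t)); rewrite /cis /= cosN sinN. Qed.

Lemma normc_cis t : normc (cis t) = 1.
Proof. by rewrite /normc /= cos2Dsin2 sqrtr1. Qed.

Lemma cis_2pi : cis (2 * pi) = 1.
Proof. by rewrite /cis mulr_natl cos2pi sin2pi. Qed.

Lemma sin_lipschitz t u : `|sin t - sin u| <= `|t - u|.
Proof.
wlog ut : t u / u <= t.
  by move=> W; case/orP: (le_total u t) => /W// h; rewrite distrC (distrC t).
have h := @MVT_segment R sin cos u t ut.
have [|c _ ->] := h (fun=> fun _ => is_derive_sin _).
  apply: continuous_subspaceT; exact: continuous_sin.
by rewrite normrM ler_piMl// cos_max.
Qed.

Lemma sqr_sin_le t : sin t ^+ 2 <= t ^+ 2.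
Proof.
have := sin_lipschitz t 0; rewrite sin0 !subr0 => h.
by rewrite -real_normK ?num_real// -[t ^+ 2]real_normK ?num_real// ler_pXn2r ?nnegrE.
Qed.

Lemma normc_sub_cis1 t : normc (1 - cis t) ^+ 2 = 4 * sin (t / 2) ^+ 2.
Proof.
rewrite sqr_normcE /cis /=.
have -> : cos t = cos ((t / 2) *+ 2) by congr cos; rewrite mulr2n; field.
have -> : sin t = sin ((t / 2) *+ 2) by congr sin; rewrite mulr2n; field.
rewrite cos_mulr2n sin_mulr2n !mulr2n.
have := cos2Dsin2 (t / 2); set c := cos _; set s := sin _ => h.
nra.
Qed.

Lemma normc_sub_cis t u : normc (cis t - cis u) <= `|t - u|.
Proof.
have -> : cis t - cis u = - cis t * (1 - cis (u - t)) * -1 - 0.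
  rewrite subr0 mulrN1 mulNr opprK mulrBr mulr1 -cisD; congr (_ - cis _); ring.
rewrite subr0 !normcM !normcN normc1 normc_cis mul1r mulr1.
rewrite -(@ler_pXn2r _ 2)// ?nnegrE ?normc_ge0// normc_sub_cis1.
have := sqr_sin_le ((u - t) / 2); rewrite real_normK ?num_real//; nra.
Qed.

Lemma cos_ge_sqr t : 1 - t ^+ 2 / 2 <= cos t.
Proof.
have -> : cos t = cos ((t / 2) *+ 2) by congr cos; rewrite mulr2n; field.
rewrite cos_mulr2n cos2sin2.
by have := sqr_sin_le (t / 2); nra.
Qed.

(** A crude form of Jordan's inequality: the cosine is at least 1/2 on [0, 1], and
beyond 1 the sine is still increasing while t is at most 2. *)
Lemma le_4sin t : 0 <= t <= pi / 2 -> t <= 4 * sin t.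
Proof.
have small (u : R) : 0 <= u <= 1 -> u <= 2 * sin u.
  move=> /andP[u0 u1].
  have [|c] := @MVT_segment R sin cos 0 u u0 (fun=> fun _ => is_derive_sin _).
    apply: continuous_subspaceT; exact: continuous_sin.
  rewrite in_itv /= sin0 !subr0 => /andP[c0 cu] ->.
  have := cos_ge_sqr c; nra.
move=> /andP[t0 tpi].
have [t1|t1] := leP t 1; first by have := small t; rewrite t0 t1 => /(_ isT); lra.
have /ltW : sin 1 < sin t.
  have p2 := @pihalf_ge1 R.
  by rewrite ltr_sin// in_itv /=; apply/andP; split; lra.
have := small 1; rewrite ler01 lexx => /(_ isT).
have := @pihalf_lt2 R; lra.
Qed.
End Modulus.

(** * Fourier analysis on a cyclic group *)

Section FiniteFourier.
Variables (R : realType) (N : nat).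
Hypothesis N_gt0 : (0 < N)%N.
Implicit Types (y b c : nat -> R[i]) (q : R) (r j k : nat).

Definition freq r : R := 2 * pi * r%:R / N%:R.
Definition dft c r : R[i] := \sum_(0 <= j < N) c j * cis (freq r) ^+ j.

Let N_neq0 : N%:R != 0 :> R. Proof. by rewrite pnatr_eq0 -lt0n. Qed.

Lemma cis_freqN r : cis (freq r) ^+ N = 1.
Proof.
rewrite cisX /freq mulrCA divff// mulr1 mulrC -cisX cis_2pi expr1n.
by [].
Qed.

Lemma sin_freq_neq0 j k : (j < N)%N -> (k < j)%N -> sin (pi * (j - k)%:R / N%:R) != 0 :> R.
Proof.
move=> jN kj; apply: lt0r_neq0; apply: sin_gt0_pi.
have N0 : 0 < N%:R :> R by rewrite ltr0n.
rewrite divr_gt0 ?mulr_gt0 ?pi_gt0 ?ltr0n ?subn_gt0//=.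
rewrite ltr_pdivrMr// ltr_pM2l ?pi_gt0// ltr_nat; lia.
Qed.

Lemma dft_orthogonal j k : (j < N)%N -> (k < N)%N ->
  \sum_(0 <= r < N) cis (freq r) ^+ j * (cis (freq r) ^+ k)^* =
  (if j == k then N%:R else 0) :> R[i].
Proof.
move=> jN kN; pose w : R[i] := cis (2 * pi * (j%:R - k%:R) / N%:R).
have -> : \sum_(0 <= r < N) cis (freq r) ^+ j * (cis (freq r) ^+ k)^* =
    \sum_(0 <= r < N) w ^+ r.
  apply: eq_bigr => r _; rewrite !cisX conj_cis -cisD; congr cis.
  by rewrite /freq; field.
have [jk|jk] := eqVneq j k.
  rewrite /w jk subrr mulr0 mul0r cis0.
  by under eq_bigr do rewrite expr1n; rewrite sumr_const_nat subn0.
have wN : w ^+ N = 1.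
  have -> : w ^+ N = cis (freq j) ^+ N * (cis (freq k) ^+ N)^*.
    by rewrite !cisX conj_cis -cisD; congr cis; rewrite /freq; field.
  by rewrite !cis_freqN mul1r rmorph1.
have w1 : w - 1 != 0.
  have nw : normc (1 - w) ^+ 2 != 0.
    rewrite normc_sub_cis1 mulf_neq0// expf_neq0//.
    have [kj|jk'|e] := ltngtP k j; last by rewrite e eqxx in jk.
      rewrite (_ : _ / 2 = pi * (j - k)%:R / N%:R) ?sin_freq_neq0//.
      by rewrite natrB 1?ltnW//; field.
    rewrite (_ : _ / 2 = - (pi * (k - j)%:R / N%:R)) ?sinN ?oppr_eq0 ?sin_freq_neq0//.
    by rewrite natrB 1?ltnW//; field.
  by apply: contraNneq nw => e; rewrite -opprB e oppr0 normc0 expr0n.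
by apply: (mulfI w1); rewrite big_mkord -subrX1 wN subrr mulr0.
Qed.

Lemma parseval y :
  \sum_(0 <= r < N) normc (dft y r) ^+ 2 = N%:R * \sum_(0 <= j < N) normc (y j) ^+ 2.
Proof.
apply: complexI; rewrite rmorph_sum /= rmorphM /= rmorph_sum /= rmorph_nat.
transitivity (\sum_(0 <= j < N) \sum_(0 <= k < N) y j * (y k)^* *
   (\sum_(0 <= r < N) cis (freq r) ^+ j * (cis (freq r) ^+ k)^*)).
  under [RHS]eq_bigr => j _.
    under eq_bigr => k _ do rewrite mulr_sumr.
    rewrite exchange_big /=; over.
  rewrite exchange_big /=; apply: eq_bigr => r _.
  rewrite sqr_normc_conj /dft rmorph_sum /= mulr_suml; apply: eq_bigr => j _.
  rewrite mulr_sumr; apply: eq_bigr => k _.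
  by rewrite rmorphM /= mulrACA.
rewrite mulr_sumr; apply: eq_big_nat => j /andP[_ jN].
rewrite (bigD1_seq j) ?mem_index_iota ?iota_uniq//= ?jN// dft_orthogonal// eqxx.
rewrite big_nat_cond big1 => [|k /andP[/andP[_ kN] kj]].
  by rewrite addr0 mulrC sqr_normc_conj.
by rewrite dft_orthogonal// eq_sym (negbTE kj) mulr0.
Qed.

Lemma dft_geometric q r :
  dft (fun j => q%:C ^+ j) r * (1 - q%:C * cis (freq r)) = 1 - q%:C ^+ N.
Proof.
rewrite /dft; under eq_bigr do rewrite -exprMn.
rewrite -[LHS]opprK -mulrN opprB big_mkord mulrC -subrX1 opprB exprMn cis_freqN.
by rewrite mulr1.
Qed.

(** Summation by parts on the cycle: y j - q * y (j - 1) is the j-th damped term, except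
at j = 0, where the cyclic predecessor y (N - 1) intervenes.  Damping makes this
wrap-around term negligible when N is large. *)
Lemma dft_partial_sums b q r : let y j := q%:C ^+ j * \sum_(0 <= i < j.+1) b i in
  dft y r * (1 - q%:C * cis (freq r)) =
  dft (fun j => q%:C ^+ j * b j) r - q%:C * y N.-1.
Proof.
move=> y; set z := cis (freq r).
have zN : z ^+ N = 1 by exact: cis_freqN.
have [M eN] : exists M, N = M.+1 by exists N.-1; rewrite prednK.
rewrite /dft eN /= mulrBr mulr1 -/z.
have step : \sum_(0 <= j < M.+1) y j * z ^+ j =
   \sum_(0 <= j < M.+1) q%:C ^+ j * b j * z ^+ j +
   \sum_(0 <= j < M) y j * z ^+ j * (q%:C * z).
  rewrite big_nat_recl// [in RHS]big_nat_recl// /y big_nat1 !expr0 -addrA; congr +%R.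
  rewrite -big_split /=; apply: eq_bigr => j _.
  by rewrite big_nat_recr//= !exprS; ring.
rewrite {1}step [X in _ - X * _]big_nat_recr//= mulrDl mulr_suml.
rewrite [y M * _ * _](_ : _ = q%:C * y M); last first.
  by rewrite -[RHS]mulr1 -zN eN exprSr; ring.
by ring.
Qed.

(** The transform of the damped partial sums is that of the damped terms times
1 / (1 - q z), at the root of unity z.  At the roots close to 1, where this multiplier
may be large, the transform is bounded pointwise by A, and the mean square of the
multiplier comes from Parseval applied to a geometric sequence.  At the other roots
the multiplier is at most of order 1 / delta, and Parseval gives the transform in mean
square. *)
Lemma partial_sums_mean_square b q (A B delta : R) :
  1 / 2 <= q < 1 -> q ^+ N <= 1 / 2 -> 0 < delta -> 0 <= A ->
  q ^+ N * normc (\sum_(0 <= j < N) b j) <= 1 ->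
  (forall r, (r < N)%N -> normc (1 - cis (freq r)) <= delta ->
     normc (dft (fun j => q%:C ^+ j * b j) r) <= A) ->
  \sum_(0 <= j < N) q ^+ j.*2 * normc (b j) ^+ 2 <= B ->
  \sum_(0 <= j < N) q ^+ j.*2 * normc (\sum_(0 <= i < j.+1) b i) ^+ 2 <=
  4 * (A + 1) ^+ 2 / (1 - q ^+ 2) + 16 * (B + 1) / delta ^+ 2.
Proof.
move=> /andP[q2 q1] qN d0 A0 tail near meanB.
have q0 : 0 < q by lra.
set y := fun j => q%:C ^+ j * \sum_(0 <= i < j.+1) b i.
set c := fun j => q%:C ^+ j * b j.
have nq j : normc (q%:C ^+ j) = q ^+ j by rewrite normcX normc_real gtr0_norm.
have sq (u : nat -> R[i]) : \sum_(0 <= j < N) q ^+ j.*2 * normc (u j) ^+ 2 =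
    \sum_(0 <= j < N) normc (q%:C ^+ j * u j) ^+ 2.
  by apply: eq_bigr => j _; rewrite normcM nq exprMn -exprM muln2.
rewrite sq -/y; rewrite sq -/c in meanB.
have N0 : 0 < N%:R :> R by rewrite ltr0n.
have e1 : normc (q%:C * y N.-1) <= 1.
  by rewrite /y mulrA -exprS prednK// normcM nq.
pose z r := cis (freq r).
pose D r := normc (1 - q%:C * z r) ^+ 2.
have D0 r : 0 < D r.
  rewrite exprn_gt0// lt_neqAle normc_ge0 andbT eq_sym.
  apply/eqP => h; have : 1 - q%:C * z r = 0 by apply: eq0_normc.
  move=> /eqP; rewrite subr_eq0 => /eqP e; have := congr1 (@normc R) e.
  by rewrite normc1 normcM normc_real gtr0_norm// normc_cis mulr1; lra.
(* The factor q >= 1 / 2 lets the undamped chord |1 - z| bound |1 - q z| from below. *)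
have DE r : D r = (1 - q) ^+ 2 + q * normc (1 - z r) ^+ 2.
  rewrite /D !sqr_normcE /z /cis /=; have := cos2Dsin2 (freq r).
  set co := cos _; set si := sin _ => h.
  transitivity ((1 - q) ^+ 2 + q * ((1 - co) ^+ 2 + (0 - si) ^+ 2) +
      (q ^+ 2 - q) * (co ^+ 2 + si ^+ 2 - 1)); first by ring.
  by rewrite h; ring.
have yE r : normc (dft y r) ^+ 2 * D r = normc (dft c r - q%:C * y N.-1) ^+ 2.
  by rewrite -dft_partial_sums normcM exprMn.
have geo : \sum_(0 <= r < N) (D r)^-1 <= N%:R * (4 / (1 - q ^+ 2)).
  have /(congr1 (fun x => x / (1 - q ^+ N) ^+ 2)) := parseval (fun j => q%:C ^+ j).
  have qN1 : 0 < 1 - q ^+ N by lra.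
  rewrite mulr_suml (eq_bigr (fun r => (D r)^-1)) => [->|r _].
    rewrite -mulrA ler_wpM2l ?ler0n//.
    have -> : \sum_(0 <= j < N) normc (q%:C ^+ j) ^+ 2 = (1 - (q ^+ N) ^+ 2) / (1 - q ^+ 2).
      rewrite (eq_bigr (fun j => (q ^+ 2) ^+ j)) => [|j _]; last by rewrite nq -!exprM mulnC.
      apply: (canRL (mulfK _)); first by rewrite subr_eq0; apply/eqP; nra.
      rewrite big_mkord -[LHS]opprK -mulrN opprB mulrC -subrX1 opprB -!exprM mulnC.
      by [].
    have qN0 : 0 < q ^+ N by rewrite exprn_gt0.
    set Q := q ^+ N in qN qN1 qN0 *.
    rewrite [leLHS](_ : _ = ((1 - Q ^+ 2) / (1 - Q) ^+ 2) / (1 - q ^+ 2)); last by rewrite mulrAC.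
    rewrite ler_pM2r ?invr_gt0; last by nra.
    by rewrite ler_pdivrMr ?exprn_gt0//; nra.
  have /(congr1 (fun x => normc x ^+ 2)) := dft_geometric q r.
  rewrite normcM exprMn -/(D r).
  have -> : normc (1 - q%:C ^+ N) = 1 - q ^+ N.
    by rewrite -rmorphXn -(rmorph1 (real_complex R)) -rmorphB [LHS]normc_real gtr0_norm.
  have h1 := lt0r_neq0 qN1; have h2 := lt0r_neq0 (D0 r).
  move=> <-; field; rewrite h2 /=.
  have := dft_geometric q r => h3; apply/eqP => h4; move: h3; rewrite (eq0_normc h4) mul0r.
  move=> /esym/eqP; rewrite subr_eq0 => /eqP/(congr1 (@normc R)).
  by rewrite normc1 nq; lra.
(* Both kinds of frequencies are covered by the sum of the two bounds. *)
have main : \sum_(0 <= r < N) normc (dft y r) ^+ 2 <=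
    \sum_(0 <= r < N) ((A + 1) ^+ 2 / D r +
       (8 * normc (dft c r) ^+ 2 + 8) * (delta ^+ 2)^-1 * 2).
  rewrite big_nat_cond [leRHS]big_nat_cond.
  apply: ler_sum => r /andP[/andP[_ rN] _].
  have -> : normc (dft y r) ^+ 2 = normc (dft c r - q%:C * y N.-1) ^+ 2 / D r.
    by rewrite -yE mulfK// lt0r_neq0.
  have d20 : 0 < (delta ^+ 2)^-1 by rewrite invr_gt0 exprn_gt0.
  have [nr|fr] := leP (normc (1 - z r)) delta.
    rewrite -[leLHS]addr0 lerD ?ler_pM2r ?invr_gt0//.
      rewrite ler_pXn2r ?nnegrE ?normc_ge0 ?addr_ge0//.
      by rewrite (le_trans (normcB _ _))// lerD// near.
    by rewrite mulr_ge0// mulr_ge0// ?(ltW d20)// addr_ge0// mulr_ge0// sqr_ge0.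
  rewrite -[leLHS]add0r lerD//.
    by rewrite divr_ge0 ?sqr_ge0// ltW.
  have DL : (delta ^+ 2) / 2 <= D r.
    rewrite DE; have : delta ^+ 2 <= normc (1 - z r) ^+ 2.
      by rewrite ler_pXn2r ?nnegrE ?normc_ge0 ?ltW.
    have := sqr_ge0 (1 - q); have := sqr_ge0 delta; nra.
  have num : normc (dft c r - q%:C * y N.-1) ^+ 2 <= 2 * normc (dft c r) ^+ 2 + 2.
    rewrite (le_trans (normc_sqrD _ _))// lerD// normcN.
    rewrite ler_piMr// expr_le1 ?normc_ge0//.
  have Di : (D r)^-1 <= 2 * (delta ^+ 2)^-1.
    move: (D r) (D0 r) DL => x x0 DL.
    have : (x)^-1 <= (delta ^+ 2 / 2)^-1.
      by rewrite lef_pV2// posrE// divr_gt0// exprn_gt0.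
    by rewrite invfM invrK mulrC.
  have := sqr_ge0 (normc (dft c r)).
  have : 0 < (D r)^-1 by have := D0 r; rewrite -invr_gt0.
  set I := (D r)^-1 in Di *; set E := (delta ^+ 2)^-1 in Di d20 *.
  set u := normc (dft c r) ^+ 2 in num *; set v := normc (_ - _) ^+ 2 in num *.
  move=> I0 _; have u0 : 0 <= u by exact: sqr_ge0.
  have v0 : 0 <= v by exact: sqr_ge0.
  apply: (@le_trans _ _ ((2 * u + 2) * (2 * E))); last by nra.
  by apply: ler_pM => //; exact: ltW.
rewrite -(ler_pM2l N0) -parseval (le_trans main)//.
rewrite big_split /= -mulr_sumr -!mulr_suml big_split /= -mulr_sumr parseval sumr_const_nat subn0.
rewrite [leRHS]mulrDr; apply: lerD.
  rewrite [leRHS](_ : _ = (A + 1) ^+ 2 * (N%:R * (4 / (1 - q ^+ 2)))); last by ring.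
  by rewrite ler_wpM2l ?sqr_ge0.
rewrite [leRHS](_ : _ = (8 * (N%:R * B) + 8 * N%:R) * (delta ^+ 2)^-1 * 2); last by ring.
rewrite -[8 *+ N]mulr_natr ler_pM2r// ler_pM2r ?invr_gt0 ?exprn_gt0//.
by rewrite lerD2r// ler_pM2l// ler_pM2l.
Qed.

(** On the half circle past pi the argument has to be lowered by a full turn before it
is comparable with the chord. *)
Lemma small_argument r (delta : R) : (r < N)%N -> normc (1 - cis (freq r)) <= delta ->
  exists2 phi : R, `|phi| <= 4 * delta & cis (freq r) = cis phi.
Proof.
move=> rN h.
have N0 : 0 < N%:R :> R by rewrite ltr0n.
have y0 : 0 <= freq r by rewrite divr_ge0// ?mulr_ge0// ?pi_ge0.
have ypi : freq r < 2 * pi.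
  by rewrite ltr_pdivrMr// ltr_pM2l ?ltr_nat// mulr_gt0// pi_gt0.
have s0 : 0 <= sin (freq r / 2) by apply: sin_ge0_pi; apply/andP; split; lra.
have {h} h : 2 * sin (freq r / 2) <= delta.
  rewrite (le_trans _ h)// -(@ler_pXn2r _ 2) ?nnegrE ?mulr_ge0 ?normc_ge0//.
  by rewrite normc_sub_cis1; nra.
have [yh|yh] := leP (freq r / 2) (pi / 2).
  exists (freq r) => //; rewrite ger0_norm//.
  have := @le_4sin R (freq r / 2); rewrite yh andbT => /(_ _) h1.
  have : freq r / 2 <= 4 * sin (freq r / 2) by apply: h1; lra.
  by lra.
exists (freq r - 2 * pi).
  have := @le_4sin R (pi - freq r / 2).
  have -> : sin (pi - freq r / 2) = sin (freq r / 2).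
    by rewrite sinB sinpi cospi; ring.
  move=> h1; have : pi - freq r / 2 <= 4 * sin (freq r / 2).
    by apply: h1; apply/andP; split; lra.
  by rewrite ler0_norm; lra.
have -> : freq r = (freq r - 2 * pi) + 2 * pi by ring.
by rewrite cisD cis_2pi mulr1 addrK.
Qed.

End FiniteFourier.

(** * Harmonic sums *)

Section HarmonicSums.
Variable R : realType.
Implicit Types (a u v : R) (n m K : nat).

Lemma lnS_lower n : (0 < n)%N -> n.+1%:R^-1 <= ln (n.+1%:R : R) - ln n%:R.
Proof.
move=> n0; have n0' : 0 < n%:R :> R by rewrite ltr0n.
have n1' : 0 < n.+1%:R :> R by rewrite ltr0n.
have -> : ln (n.+1%:R : R) - ln n%:R = - ln (n%:R / n.+1%:R).
  by rewrite ln_div ?posrE// opprB.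
have -> : n%:R / n.+1%:R = 1 + - n.+1%:R^-1 :> R.
  by rewrite -natr1; field; rewrite natr1 lt0r_neq0.
rewrite lerNr le_ln1Dx// ltrN2 invf_lt1// ltr1n; lia.
Qed.

Lemma lnS_upper n : (0 < n)%N -> n%:R^-1 <= 2 * (ln (n.+1%:R : R) - ln n%:R).
Proof.
move=> n0; have n0' : 0 < n%:R :> R by rewrite ltr0n.
apply: (@le_trans _ _ (2 * n.+1%:R^-1)); last by rewrite ler_pM2l// lnS_lower.
rewrite -natr1 ler_pdivlMr ?ltr0n// mulrC ler_pdivrMr//.
have : 1 <= n%:R :> R by rewrite ler1n.
by lra.
Qed.

Lemma ln_nat_ge0 n : 0 <= ln n%:R :> R.
Proof. by case: n => [|n]; [rewrite ln0 | rewrite ln_ge0// ler1n]. Qed.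

Lemma ler_lnn m n : (0 < m)%N -> (m <= n)%N -> ln m%:R <= ln n%:R :> R.
Proof. by move=> m0 mn; rewrite ler_ln ?posrE ?ltr0n ?ler_nat//; lia. Qed.

Lemma sum_inv_le K : \sum_(1 <= n < K.+1) n%:R^-1 <= 1 + ln K%:R :> R.
Proof.
elim: K => [|K IH]; first by rewrite big_geq// addr_ge0// ln_nat_ge0.
rewrite big_nat_recr//=; case: K IH => [|K] IH.
  by rewrite big_geq// ln1 invr1 add0r addr0.
apply: (le_trans (lerD IH (@lnS_lower K.+1 isT))).
by set x := ln K.+1%:R; set y := ln K.+2%:R; rewrite -addrA subrKC.
Qed.

Lemma expR_Nln n : (0 < n)%N -> expR (- ln n%:R) = n%:R^-1 :> R.
Proof. by move=> n0; rewrite expRN lnK// posrE ltr0n. Qed.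

(** Comparison with a telescoping sum, in place of the integral of t^(-1-a). *)
Lemma sum_power_tail a m K : 0 < a -> (0 < m)%N ->
  \sum_(m.+1 <= n < K) n%:R^-1 * expR (- a * ln n%:R) <= a^-1 * expR (- a * ln m%:R).
Proof.
move=> a0 m0.
have [Km|mK] := leqP K m.+1.
  by rewrite big_geq// mulr_ge0 ?expR_ge0// invr_ge0 ltW.
suff tele k : \sum_(m.+1 <= n < m.+1 + k) n%:R^-1 * expR (- a * ln n%:R) <=
    a^-1 * (expR (- a * ln m%:R) - expR (- a * ln (m + k)%:R)).
  rewrite -(subnKC (ltnW mK)) (le_trans (tele _))// ler_pM2l ?invr_gt0//.
  by rewrite gerBl expR_ge0.
elim: k => [|k IH]; first by rewrite addn0 big_geq// addn0 subrr mulr0.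
rewrite addnS big_nat_recr ?leq_addr//= (le_trans (lerD IH (lexx _)))//.
rewrite addSn addnS -lerBrDl -mulrBr opprB addrC addrA subrK.
have := @lnS_lower (m + k); rewrite addn_gt0 m0 => /(_ isT).
set x := ln (m + k).+1%:R; set y := ln (m + k)%:R => h.
have -> : expR (- a * y) = expR (- a * x) * expR (a * (x - y)).
  by rewrite -expRD; congr expR; ring.
set E := expR (- a * x); have E0 : 0 < E by exact: expR_gt0.
rewrite mulrC -[X in _ - X]mulr1 -mulrBr mulrCA ler_pM2l//.
have := expR_ge1Dx (a * (x - y)) => h1.
rewrite (le_trans h)// -(ler_pM2l a0) mulrA divff ?gt_eqF// mul1r; lra.
Qed.

Lemma sum_power_le a K : 0 < a ->
  \sum_(1 <= n < K) n%:R^-1 * expR (- a * ln n%:R) <= 1 + a^-1.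
Proof.
move=> a0; case: K => [|[|K]].
- by rewrite big_geq// addr_ge0// invr_ge0 ltW.
- by rewrite big_geq// addr_ge0// invr_ge0 ltW.
rewrite big_ltn// ln1 mulr0 expR0 invr1 mulr1 lerD2l.
by rewrite (le_trans (sum_power_tail _ a0 _))// ln1 mulr0 expR0 mulr1.
Qed.

Lemma sum_inv_sqr_le K : \sum_(1 <= n < K) (n%:R^-1) ^+ 2 <= 2 :> R.
Proof.
rewrite big_nat_cond (eq_bigr (fun n => n%:R^-1 * expR (- 1 * ln n%:R))).
  by rewrite -big_nat_cond (le_trans (sum_power_le _ ltr01))// invr1.
by move=> n /andP[/andP[n0 _] _]; rewrite mulN1r expR_Nln.
Qed.

(** Each term above n is compared with the logarithmic increment on its left, and
each term below n with the one on its right; only n itself is left over. *)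
Lemma sum_inv_window u v n K : (0 < n)%N -> u <= ln n%:R < v ->
  \sum_(1 <= m < K | u <= ln m%:R < v) m%:R^-1 <= 2 * (v - u) + n%:R^-1.
Proof.
move=> n0 /andP[un nv].
have below k : (0 < k)%N -> \sum_(1 <= m < k | u <= ln m%:R < v) m%:R^-1 <=
    2 * (Num.max (ln k%:R) u - u).
  elim: k => [//|[|k] IH] _; first by rewrite big_geq// mulr_ge0// subr_ge0 le_max lexx orbT.
  rewrite big_mkcond big_nat_recr//= -big_mkcond /=.
  have := ler_lnn (isT : (0 < k.+1)%N) (leqnSn k.+1).
  have := @lnS_upper k.+1 isT; have := IH isT.
  set x := ln k.+1%:R; set y := ln k.+2%:R; move=> h1 h2 xy.
  case: ifP => [/andP[ux xv]|_].
    rewrite (max_idPl (le_trans ux xy)); rewrite (max_idPl ux) in h1.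
    by apply: (le_trans (lerD h1 h2)); lra.
  rewrite addr0 (le_trans h1)// ler_pM2l// lerD2r ge_max !le_max xy lexx orbT.
  by rewrite orTb.
have above k : (n < k)%N -> \sum_(n.+1 <= m < k | u <= ln m%:R < v) m%:R^-1 <=
    Num.min (ln k.-1%:R) v - ln n%:R.
  elim: k => [//|k IH]; rewrite ltnS leq_eqVlt => /orP[/eqP <-|nk].
    by rewrite big_geq//= subr_ge0 le_min lexx ltW.
  rewrite big_mkcond big_nat_recr//= -big_mkcond /=.
  have k0 : (0 < k.-1)%N by lia.
  have := lnS_lower k0; have := ler_lnn k0 (leq_pred k); have := IH nk.
  rewrite prednK; last by lia.
  set x := ln k.-1%:R; set y := ln k%:R; move=> h1 xy h2.
  case: ifP => [/andP[ux /ltW xv]|_].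
    rewrite (min_idPl xv); rewrite (min_idPl (le_trans xy xv)) in h1.
    by apply: (le_trans (lerD h1 h2)); lra.
  rewrite addr0 (le_trans h1)// lerD2r le_min !ge_min xy lexx orbT.
  by rewrite orTb.
have bn : \sum_(1 <= m < n | u <= ln m%:R < v) m%:R^-1 <= 2 * (ln n%:R - u).
  by rewrite (le_trans (below _ n0))// (max_idPl un).
have [Kn|nK] := leqP K n.
  rewrite (@le_trans _ _ (\sum_(1 <= m < n | u <= ln m%:R < v) m%:R^-1))//.
    have [K1|K1] := leqP 1 K; last by rewrite [leLHS]big_geq ?sumr_ge0// ltnW.
    by rewrite [leRHS](big_cat_nat _ (n := K))//= lerDl sumr_ge0.
  rewrite (le_trans bn)//.
  have : 0 <= n%:R^-1 :> R by rewrite invr_ge0.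
  by move: nv; set l := ln n%:R; lra.
rewrite (big_cat_nat _ (n := n))//=; last exact: ltnW.
rewrite big_mkcond [X in _ + X]big_mkcond /= [X in _ + X]big_ltn// un nv /= -!big_mkcond /=.
apply: (le_trans (lerD bn (lerD (lexx _) (above _ nK)))).
have : Num.min (ln K.-1%:R) v <= v by rewrite ge_min lexx orbT.
by move: un nv; set l := ln n%:R; set i := n%:R^-1; set mm := Num.min _ _; lra.
Qed.

(** When no particular element of the window is singled out, the exceptional term 1 / n
is at most 1. *)
Lemma sum_inv_window1 u v K : u <= v ->
  \sum_(1 <= m < K | u <= ln m%:R < v) m%:R^-1 <= 2 * (v - u) + 1.
Proof.
move=> uv.
have [/hasP[n nK nw]|/hasPn none] :=
  boolP (has (fun m : nat => u <= ln (m%:R : R) < v) (index_iota 1 K)).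
  have n0 : (0 < n)%N by move: nK; rewrite mem_index_iota; lia.
  rewrite (le_trans (sum_inv_window K n0 nw))// lerD2l invf_le1 ?ltr0n//.
  by rewrite ler1n.
rewrite big_seq_cond big1 => [|m /andP[mK mw]]; last by rewrite (negbTE (none _ mK)) in mw.
by rewrite addr_ge0// mulr_ge0// subr_ge0.
Qed.
End HarmonicSums.

(** * Chebyshev estimates *)

Section PrimeSums.
Variable R : realType.
Implicit Types (u v : R) (n m p K X : nat).

Lemma central_bin_le m : ('C(m.*2.+1, m) <= 4 ^ m)%N.
Proof.
have m2 : (m.*2.+1 - m = m.+1)%N by lia.
rewrite -(@leq_pmul2l 2)// -[4%N]/(2 ^ 2)%N -expnM mul2n [(2 * m)%N]mul2n -expnS.
rewrite (_ : (2 ^ _)%N = ((1 + 1) ^ m.*2.+1)%N)// expnDn.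
under eq_bigr do rewrite !exp1n !muln1.
have hm : (m < m.*2.+2)%N by lia.
have hm1 : (m.+1 < m.*2.+2)%N by lia.
rewrite (bigD1 (Ordinal hm))//= (bigD1 (Ordinal hm1))/=; last first.
  by rewrite -val_eqE /= eqn_leq ltnn.
have -> : 'C(m.*2.+1, m.+1) = 'C(m.*2.+1, m) by rewrite -m2 bin_sub//; lia.
by rewrite addnA addnn leq_addr.
Qed.

Lemma prime_ndvd_fact p m : prime p -> (m < p)%N -> ~~ (p %| m`!)%N.
Proof.
move=> pp; elim: m => [|m IH] mp; first by rewrite fact0 dvdn1 gtn_eqF// prime_gt1.
by rewrite factS Euclid_dvdM// negb_or IH ?gtnNdvd// ltnW.
Qed.

(** For n = 2m + 1, the primes beyond m + 1 all divide the central binomial coefficient,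
which is at most 4^m; the others are treated by induction.  An even n > 2 is not
prime. *)
Lemma primorial_le n : (\prod_(1 <= p < n.+1 | prime p) p <= 4 ^ n)%N.
Proof.
elim/ltn_ind: n => n IH.
have [n2|n2] := leqP n 2.
  by case: n n2 {IH} => [|[|[|//]]] _; rewrite unlock /=.
have [nodd|neven] := boolP (odd n); last first.
  have np : ~~ prime n by apply: contra neven => /even_prime [e2|//]; rewrite e2 in n2.
  rewrite big_mkcond big_nat_recr//=; last by lia.
  rewrite (negbTE np) muln1 -big_mkcond -{1}(prednK (ltnW (ltnW n2))).
  by rewrite (leq_trans (IH _ _))// ?leq_pexp2l//; lia.
have [m en] : exists m, n = m.*2.+1 by exists n./2; rewrite -[LHS]odd_double_half nodd.
rewrite (big_cat_nat _ (n := m.+2))//=; last by lia.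
rewrite (_ : 4 ^ n = 4 ^ m.+1 * 4 ^ m)%N; last by rewrite -expnD; congr expn; lia.
apply: leq_mul; first by apply: IH; lia.
apply: leq_trans (central_bin_le m); apply: dvdn_leq; first by rewrite bin_gt0; lia.
apply/unstable.Gauss_dvd_prod.
  rewrite map_id; set s := [seq _ <- _ | _].
  have us : uniq s by rewrite filter_uniq// iota_uniq.
  have ps : all prime s by exact: filter_all.
  rewrite uniq_pairwise in us; apply: sub_in_pairwise us => [p r|]; last exact: ps.
  move=> pp rp /= pr; rewrite prime_coprime//.
  by rewrite dvdn_prime2.
move=> p; rewrite mem_index_iota => /andP[mp pn] pp.
have /(congr1 (dvdn p)) := @bin_fact m.*2.+1 m ltac:(lia).
have mp2 : (m.*2.+1 - m < p)%N by lia.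
rewrite Euclid_dvdM// Euclid_dvdM// (negbTE (prime_ndvd_fact pp (ltnW mp))).
rewrite (negbTE (prime_ndvd_fact pp mp2)) !orbF => ->.
by rewrite dvdn_fact//; lia.
Qed.

Lemma sum_ln_primes_le n : \sum_(1 <= p < n.+1 | prime p) ln p%:R <= n%:R * ln 4 :> R.
Proof.
have -> : \sum_(1 <= p < n.+1 | prime p) ln p%:R =
    ln (\prod_(1 <= p < n.+1 | prime p) p)%:R :> R.
  rewrite -[LHS]expRK expR_sum natr_prod; congr ln.
  by apply: eq_bigr => p pp; rewrite lnK// posrE ltr0n prime_gt0.
rewrite mulr_natl -lnXn// -natrX ler_lnn ?primorial_le//.
by rewrite prodn_cond_gt0// => p /prime_gt0.
Qed.

Definition chebyshev_const : R := expR 1 * ln 4.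

Lemma chebyshev_const_ge0 : 0 <= chebyshev_const.
Proof. by rewrite mulr_ge0// ?expR_ge0// ln_ge0// ler1n. Qed.

Lemma sum_nat_widen (P : pred nat) (F : nat -> R) m n : (m <= n)%N ->
  (forall i, P i -> 0 <= F i) ->
  \sum_(1 <= i < m | P i) F i <= \sum_(1 <= i < n | P i) F i.
Proof.
move=> mn F0; have [m1|m1] := leqP 1 m; last by rewrite [leLHS]big_geq ?sumr_ge0// ltnW.
by rewrite [leRHS](big_cat_nat _ (n := m))//= lerDl sumr_ge0.
Qed.

(** A unit window of logarithms has its primes in (0, e^(u + 1)] and their weights 1 / p
at most e^(-u), so the bound does not depend on u. *)
Lemma sum_ln_primes_window u K :
  \sum_(1 <= p < K | prime p && (u <= ln p%:R <= u + 1)) ln p%:R / p%:R <= chebyshev_const.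
Proof.
set M := Num.truncn (expR (u + 1)).
have memM p : prime p -> ln (p%:R : R) <= u + 1 -> (p < M.+1)%N.
  move=> pp; rewrite -ler_expR lnK ?posrE ?ltr0n ?prime_gt0// => h.
  by rewrite ltnS truncn_ge_nat ?expR_ge0.
apply: (@le_trans _ _ (\sum_(1 <= p < M.+1 | prime p) expR (- u) * ln p%:R)).
  rewrite (big_nat_widen _ _ _ _ _ (leq_maxr K M.+1)).
  rewrite (le_trans (sum_nat_widen (leq_maxl K M.+1) _))// => [p _|].
    by rewrite divr_ge0// ln_nat_ge0.
  rewrite big_mkcond [leRHS]big_mkcond /= ler_sum// => p _.
  case: ifP => [/andP[pp /andP[up pu]]|_]; last first.
    by case: ifP => // _; rewrite mulr_ge0 ?expR_ge0 ?ln_nat_ge0.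
  rewrite pp memM//= mulrC ler_wpM2r ?ln_nat_ge0//.
  by rewrite -expR_Nln ?prime_gt0// ler_expR lerN2.
rewrite -mulr_sumr (le_trans (ler_wpM2l (expR_ge0 _) (sum_ln_primes_le M)))//.
rewrite mulrA ler_wpM2r ?ln_ge0 ?ler1n//.
apply: (@le_trans _ _ (expR (- u) * expR (u + 1))).
  by rewrite ler_wpM2l ?expR_ge0// truncn_le ?expR_ge0.
by rewrite -expRD addKr.
Qed.

(** Covering the logarithms of the primes by unit windows. *)
Lemma sum_ln_primes_div X : (0 < X)%N ->
  \sum_(1 <= p < X.+1 | prime p) ln p%:R / p%:R <= chebyshev_const * (ln X%:R + 1).
Proof.
move=> X0; set k := Num.truncn (ln (X%:R : R)).
apply: (@le_trans _ _ (\sum_(0 <= i < k.+1) \sum_(1 <= p < X.+1 |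
    prime p && (i%:R <= ln (p%:R : R) <= i%:R + 1)) ln p%:R / p%:R)).
  under [leRHS]eq_bigr do rewrite big_mkcond.
  rewrite exchange_big /= big_mkcond [leLHS]big_nat_cond [leRHS]big_nat_cond.
  apply: ler_sum => p /andP[/andP[p1 pX] _]; case: ifP => pp; last first.
    by rewrite sumr_ge0// => i _ /=; rewrite divr_ge0 ?ln_nat_ge0.
  set j := Num.truncn (ln (p%:R : R)).
  have jk : (j < k.+1)%N by rewrite ltnS le_truncn// ler_lnn.
  rewrite (bigD1_seq j) ?mem_index_iota ?iota_uniq//=.
  have -> : j%:R <= ln (p%:R : R) <= j%:R + 1.
    have /andP[-> /ltW] := truncn_itv (ln_nat_ge0 R p).
    by rewrite -natr1.
  rewrite lerDl sumr_ge0// => i _; case: ifP => // _.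
  by rewrite divr_ge0 ?ln_nat_ge0.
apply: (@le_trans _ _ (\sum_(0 <= i < k.+1) chebyshev_const)).
  by apply: ler_sum => i _; exact: sum_ln_primes_window.
rewrite sumr_const_nat subn0 -[leLHS]mulr_natr ler_wpM2l ?chebyshev_const_ge0//.
by rewrite -natr1 lerD2r truncn_le ln_nat_ge0.
Qed.

(** Half a power of n absorbs the logarithm: ln n <= 2 n^(1/2). *)
Lemma sum_ln_div_sqr K : \sum_(1 <= n < K) ln n%:R / n%:R ^+ 2 <= 6 :> R.
Proof.
have h2 : 0 < 1 / 2 :> R by rewrite divr_gt0.
apply: (@le_trans _ _ (2 * \sum_(1 <= n < K) n%:R^-1 * expR (- (1 / 2) * ln n%:R))).
  rewrite mulr_sumr [leLHS]big_nat_cond [leRHS]big_nat_cond.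
  apply: ler_sum => n /andP[/andP[n0 _] _].
  have N0 : 0 < n%:R :> R by rewrite ltr0n.
  rewrite expr2 invfM mulrCA [leRHS]mulrCA ler_wpM2l ?invr_ge0//.
  set x := ln (n%:R : R); have -> : expR (- (1 / 2) * x) = expR (x / 2) * n%:R^-1.
    by rewrite -(expR_Nln R n0) -expRD -/x; congr expR; field.
  rewrite mulrA ler_wpM2r ?invr_ge0//.
  have := expR_ge1Dx (x / 2); lra.
rewrite (le_trans (ler_wpM2l _ (sum_power_le _ h2)))//; lra.
Qed.

End PrimeSums.

(** * Smooth integers and the Euler product *)

Section EulerProduct.
Variable R : realType.
Implicit Types (a t : R) (f G : nat -> R[i]) (n m p y X : nat).

Definition smooth y : pred nat := fun n => [pred p | (p <= y)%N].-nat n.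

Lemma smoothM y m n : smooth y (m * n)%N = smooth y m && smooth y n.
Proof. exact: pnatM. Qed.

Lemma smooth_le y n : (0 < n)%N -> (n <= y)%N -> smooth y n.
Proof.
by move=> n0 ny; apply/(pnatP _ n0) => p _ pn; rewrite inE (leq_trans (dvdn_leq n0 pn)).
Qed.

Lemma smooth0 n : (0 < n)%N -> smooth 0 n = (n == 1%N).
Proof.
move=> n0; apply/(pnatP _ n0)/eqP => [h|-> p pp]; last first.
  by rewrite dvdn1 => /eqP p1; rewrite p1 in pp.
apply/eqP; rewrite eqn_leq n0 andbT leqNgt; apply/negP => n1.
have := h _ (pdiv_prime n1) (pdiv_dvd n).
by rewrite inE leqn0 gtn_eqF// pdiv_gt0.
Qed.

Lemma smoothS_prime y n : (0 < n)%N -> prime y.+1 ->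
  smooth y n = smooth y.+1 n && ~~ (y.+1 %| n)%N.
Proof.
move=> n0 py; apply/(pnatP _ n0)/andP => [h|[/(pnatP _ n0) h yn] p pp pn].
  split; first by apply/(pnatP _ n0) => p pp pn; have := h p pp pn; rewrite !inE => /leqW.
  by apply/negP => yn; have := h _ py yn; rewrite inE ltnn.
have := h p pp pn; rewrite !inE leq_eqVlt => /orP[/eqP e|//].
by rewrite e (negbTE yn) in pn.
Qed.

Lemma smoothS_nonprime y n : (0 < n)%N -> ~~ prime y.+1 -> smooth y.+1 n = smooth y n.
Proof.
move=> n0 py; apply/(pnatP _ n0)/(pnatP _ n0) => h p pp pn; have := h p pp pn.
  by rewrite !inE leq_eqVlt => /orP[/eqP e|//]; rewrite -e pp in py.
by rewrite !inE => /leqW.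
Qed.

Lemma sum_multiples (V : nmodType) (F : nat -> V) p X : (0 < p)%N ->
  \sum_(1 <= n < X.+1 | (p %| n)%N) F n = \sum_(1 <= m < (X %/ p).+1) F (p * m)%N.
Proof.
move=> p0; elim: X => [|X IH]; first by rewrite div0n !big_geq.
rewrite big_mkcond big_nat_recr//= -big_mkcond IH /= divnS//.
case: ifP => [pX|_]; last by rewrite addr0.
rewrite add1n [RHS]big_nat_recr//=; congr (_ + F _).
by rewrite -[LHS](divnK pX) divnS// pX mulnC.
Qed.

Lemma exp_ln_small a (eta : R) : 0 < a -> 0 < eta ->
  exists2 M, (0 < M)%N & expR (- a * ln M%:R) <= eta.
Proof.
move=> a0 e0; exists (Num.truncn (expR (- ln eta / a))).+1 => //.
rewrite -[leRHS](@lnK R)// ler_expR mulNr lerNl.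
have := truncnS_gt (expR (- ln eta / a)); rewrite -ltr_ln ?posrE ?expR_gt0 ?ltr0n//.
by rewrite expRK ltr_pdivrMr// mulrC => /ltW.
Qed.

Lemma normc_tail_le G a m X (P : pred nat) : 0 < a -> (0 < m)%N ->
  (forall n, (0 < n)%N -> normc (G n) <= n%:R^-1 * expR (- a * ln n%:R)) ->
  normc (\sum_(m.+1 <= n < X | P n) G n) <= a^-1 * expR (- a * ln m%:R).
Proof.
move=> a0 m0 hG; rewrite (le_trans (normc_sum _ _ _))//.
apply: le_trans (sum_power_tail X a0 m0).
rewrite big_mkcond [leLHS]big_nat_cond [leRHS]big_nat_cond.
apply: ler_sum => n /andP[/andP[n0 _] _]; have n1 : (0 < n)%N by lia.
by case: ifP => _; rewrite ?hG// mulr_ge0 ?expR_ge0 ?invr_ge0.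
Qed.

(** The factors of the Euler product are peeled off one prime p at a time:
splitting the smooth integers according to divisibility by p multiplies the sum
by 1 - G p, up to a tail of a convergent series.  The threshold does not depend
on G, so that it serves all frequencies at once. *)
Lemma smooth_sum_euler_product a y (eps : R) : 0 < a -> 0 < eps -> exists X0,
  forall G, completely_multiplicative G ->
  (forall n, (0 < n)%N -> normc (G n) <= n%:R^-1 * expR (- a * ln n%:R)) ->
  forall X, (X0 <= X)%N ->
  normc ((\sum_(1 <= n < X | smooth y n) G n) *
         (\prod_(1 <= p < y.+1 | prime p) (1 - G p)) - 1) <= eps.
Proof.
move=> a0; elim: y eps => [|y IH] eps e0.
  exists 2%N => G [G1 _] _ X X2.
  rewrite [X in _ * X]big_geq// mulr1.
  rewrite big_nat_cond (eq_bigl (fun n => (1 <= n < X)%N && (n == 1%N))); last first.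
    by move=> n; case: (ltnP 0 n) => //= n0; rewrite smooth0.
  rewrite big_ltn_cond//= X2 big_nat_cond big_pred0 => [|n]; last first.
    by case: n => [|[|n]]//=; rewrite !andbF.
  by rewrite G1 addr0 subrr normc0 ltW.
have [py|py] := boolP (prime y.+1); last first.
  have [X0 h] := IH eps e0; exists X0 => G mG bG X XX.
  rewrite [X in _ * X](_ : _ = \prod_(1 <= p < y.+1 | prime p) (1 - G p)); last first.
    by rewrite big_mkcond big_nat_recr//= (negbTE py) mulr1 -big_mkcond.
  rewrite [X in X * _](_ : _ = \sum_(1 <= n < X | smooth y n) G n); first exact: h.
  rewrite big_nat_cond [RHS]big_nat_cond; apply: eq_bigl => n.
  by case n0: (0 < n)%N => //=; rewrite (smoothS_nonprime n0 py).
set p := y.+1 in py *.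
pose W : R := \prod_(1 <= q < y.+1) 2; have W0 : 0 < W by rewrite prodr_gt0.
have eta0 : 0 < eps / 2 * a / W by rewrite !mulr_gt0// ?invr_gt0.
have [M M0 hM] := exp_ln_small a0 eta0.
have [X0 h] := IH (eps / 2) ltac:(lra).
exists (maxn X0 (p * M).+1) => G mG bG X; rewrite geq_max => /andP[XX XM].
have p0 : (0 < p)%N by [].
have nG n : (0 < n)%N -> normc (G n) <= 1.
  move=> n0; rewrite (le_trans (bG n n0))// mulr_ile1 ?invr_ge0 ?expR_ge0//.
    by rewrite invf_le1 ?ltr0n// ler1n.
  by rewrite expR_le1 mulNr oppr_le0 mulr_ge0 ?ln_nat_ge0// ltW.
set Q := \prod_(1 <= q < y.+1 | prime q) (1 - G q).
have nQ : normc Q <= W.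
  rewrite normc_prod /W [leLHS]big_mkcond [leLHS]big_nat_cond [leRHS]big_nat_cond.
  apply: ler_prod => q.
  move=> /andP[/andP[q0 _] _]; case: ifP => _; rewrite ?normc_ge0 ?ler01 ?ler1n//=.
  by rewrite (le_trans (normcB _ _))// normc1 -[2]/(1 + 1) lerD2l nG.
have -> : \prod_(1 <= q < p.+1 | prime q) (1 - G q) = Q * (1 - G p).
  by rewrite big_mkcond big_nat_recr//= py -big_mkcond.
pose A K := \sum_(1 <= n < K | smooth p n) G n.
set B := \sum_(1 <= n < X | smooth y n) G n.
have X1 : X = X.-1.+1 by lia.
(* The multiples p * m below X are those with m below X'. *)
set X' := (X.-1 %/ p).+1.
have rec : A X = B + G p * A X'.
  rewrite /A (bigID (fun n => (p %| n)%N)) /= addrC; congr +%R.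
    rewrite /B big_nat_cond [RHS]big_nat_cond; apply: eq_bigl => n.
    by case n0: (0 < n)%N => //=; rewrite (smoothS_prime n0 py).
  under eq_bigl => n do rewrite andbC.
  rewrite big_mkcondr X1 sum_multiples// -/X' mulr_sumr [RHS]big_mkcond /=.
  apply: eq_big_nat => m /andP[m0 _].
  have [_ mulG] := mG; rewrite mulG// smoothM.
  by rewrite [smooth p p]smooth_le.
have X'M : (M <= X.-1 %/ p)%N by rewrite leq_divRL// mulnC; lia.
have split : A X - A X' = \sum_(X' <= n < X | smooth p n) G n.
  apply: (canLR (addrK _)); rewrite addrC; apply: big_cat_nat => //.
  by rewrite /X' {2}X1 ltnS leq_div.
have -> : A X * (Q * (1 - G p)) - 1 = (B * Q - 1) - G p * Q * (A X - A X').
  transitivity ((A X - G p * A X) * Q - 1); first by ring.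
  by rewrite {1}rec; ring.
rewrite (le_trans (normcB _ _))// (splitr eps) lerD//; first exact: h.
rewrite !normcM split -[eps / 2]mul1r -mulrA ler_pM ?normc_ge0 ?mulr_ge0 ?normc_ge0 ?nG//.
apply: (@le_trans _ _ (W * (a^-1 * (eps / 2 * a / W)))); last first.
  by rewrite le_eqVlt; apply/orP; left; apply/eqP; field; rewrite !gt_eqF.
apply: ler_pM; rewrite ?normc_ge0//.
have Mq : (0 < X.-1 %/ p)%N by lia.
rewrite /X' (le_trans (normc_tail_le _ _ a0 Mq bG))// ler_pM2l ?invr_gt0//.
rewrite (le_trans _ hM)// ler_expR !mulNr lerN2 ler_pM2l//.
exact: ler_lnn.
Qed.
End EulerProduct.

(** * The Dirichlet series near the line of absolute convergence *)

Section DirichletSeriesBound.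
Variable R : realType.
Implicit Types (a t : R) (f G : nat -> R[i]) (n m p y X : nat).

(** |1 - g|^-2 = |1 + g|^2 / |1 - g^2|^2, and both quotients are compared with
exponentials; this linearizes the factors of the Euler product. *)
Lemma inv_normc_1B (g : R[i]) : normc g <= 1 / 2 ->
  (normc (1 - g))^-1 <= expR (complex.Re g + 2 * normc g ^+ 2).
Proof.
move=> g2; set E := expR _; have E0 : 0 < E by exact: expR_gt0.
have ng := normc_ge0 g; have n1g := normc_ge0 (1 - g).
have s4 : normc g ^+ 2 <= 1 / 4 by nra.
have DE : normc (1 - g) ^+ 2 = 1 - 2 * complex.Re g + normc g ^+ 2.
  by rewrite !sqr_normcE; case: (g) => x y /=; ring.
have rs : complex.Re g ^+ 2 <= normc g ^+ 2.
  by rewrite sqr_normcE lerDl sqr_ge0.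
have E2 : E ^+ 2 = expR (2 * complex.Re g + normc g ^+ 2) * expR (4 / 3 * normc g ^+ 2) ^+ 2 *
    expR (1 / 3 * normc g ^+ 2).
  by rewrite !expr2 -!expRD; congr expR; field.
set r := complex.Re g in DE rs E2; set s := normc g ^+ 2 in s4 DE rs E2.
have s0 : 0 <= s by exact: sqr_ge0.
set D := normc (1 - g) in n1g DE *.
have D20 : 0 < D ^+ 2 by rewrite DE; nra.
have D0 : 0 < D by rewrite lt_neqAle n1g andbT eq_sym -sqrf_eq0 gt_eqF.
have h1 := expR_ge1Dx (2 * r + s); have h2 := expR_ge1Dx (4 / 3 * s).
have h3 := expR_ge1Dx (1 / 3 * s).
set e1 := expR (_ + _) in h1 E2; set e2 := expR (4 / 3 * s) in h2 E2; set e3 := expR _ in h3 E2.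
have key : 1 <= (E * D) ^+ 2.
  rewrite exprMn E2 DE.
  have k1 : 1 <= (e2 * (1 - s)) ^+ 2.
    by rewrite -[leLHS](expr1n _ 2) ler_pXn2r ?nnegrE//; nra.
  have k2 : (1 - s) ^+ 2 <= (1 - 2 * r + s) * e1.
    apply: (@le_trans _ _ ((1 - 2 * r + s) * (1 + (2 * r + s)))); first by nra.
    by rewrite ler_wpM2l//; nra.
  apply: (@le_trans _ _ (e2 ^+ 2 * (1 - s) ^+ 2)); first by rewrite -exprMn.
  apply: (@le_trans _ _ (e2 ^+ 2 * ((1 - 2 * r + s) * e1))).
    by rewrite ler_wpM2l// sqr_ge0.
  have : 0 <= e2 ^+ 2 * ((1 - 2 * r + s) * e1).
    rewrite mulr_ge0// ?sqr_ge0// mulr_ge0 ?expR_ge0//; nra.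
  move=> k3; have -> : e1 * e2 ^+ 2 * e3 * (1 - 2 * r + s) =
     e2 ^+ 2 * ((1 - 2 * r + s) * e1) * e3 by ring.
  by rewrite ler_peMr//; lra.
rewrite -[_^-1]div1r ler_pdivrMr// -(@ler_pXn2r _ 2) ?nnegrE ?mulr_ge0 ?(ltW E0)//.
by rewrite expr1n.
Qed.

Definition mertens_const : R := 4 * expR (2 * chebyshev_const R).

(** The weight n^(-1-a). *)
Definition damp a n : R := n%:R^-1 * expR (- a * ln n%:R).

Lemma damp_ge0 a n : 0 <= damp a n.
Proof. by rewrite mulr_ge0 ?expR_ge0 ?invr_ge0. Qed.

Lemma dampM a m n : (0 < m)%N -> (0 < n)%N -> damp a (m * n) = damp a m * damp a n.
Proof.
move=> m0 n0; rewrite /damp natrM lnM ?posrE ?ltr0n// mulrDr expRD invfM; ring.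
Qed.

Lemma damp1 a : damp a 1 = 1.
Proof. by rewrite /damp ln1 mulr0 expR0 invr1 mulr1. Qed.

Lemma damp_le a n : 0 < a -> (0 < n)%N -> damp a n <= n%:R^-1.
Proof.
move=> a0 n0; rewrite /damp ler_piMr ?invr_ge0// expR_le1 mulNr oppr_le0.
by rewrite mulr_ge0 ?ln_nat_ge0// ltW.
Qed.

(** Since 1 - n^(-a) <= a ln n.  With a = 1 / ln X, Chebyshev's estimate shows that
undoing the damping at all the primes up to X costs only a bounded amount. *)
Lemma inv_sub_damp a n : (0 < n)%N -> n%:R^-1 - damp a n <= a * (ln n%:R / n%:R).
Proof.
move=> n0; rewrite /damp -[X in X - _]mulr1 -mulrBr mulrC mulrA ler_wpM2r ?invr_ge0//.
by have := expR_ge1Dx (- a * ln (n%:R : R)); lra.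
Qed.

(** Mertens' upper bound, read off from zeta(1 + a) <= 1 + 1 / a with a = 1 / ln X: the
Euler product for the weights n^(-1-a) bounds the sum of p^(-1-a) from above. *)
Lemma sum_inv_primes X : 1 <= ln X%:R :> R ->
  expR (\sum_(1 <= p < X.+1 | prime p) p%:R^-1) <= mertens_const * ln X%:R :> R.
Proof.
move=> L1; set L := ln X%:R in L1 *; have L0 : 0 < L by lra.
have X0 : (0 < X)%N by case: (X) @L L1 {L0} => //=; rewrite ln0// ler10.
pose a := L^-1; have a0 : 0 < a by rewrite invr_gt0.
have h2 : 0 < 1 / 2 :> R by rewrite divr_gt0.
have [X0' h] := smooth_sum_euler_product X a0 h2.
pose G n := (damp a n)%:C.
have nG n : normc (G n) = damp a n by rewrite normc_real ger0_norm// damp_ge0.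
have mG : completely_multiplicative G.
  by split=> [|m n m0 n0]; rewrite /G ?damp1// dampM// rmorphM.
have {}h := h G mG (fun n _ => eq_ind_r (fun x => x <= _) (lexx _) (nG n)) _ (leqnn _).
set A := \sum_(1 <= n < X0' | smooth X n) damp a n.
set P := \prod_(1 <= p < X.+1 | prime p) (1 - damp a p).
have {}h : `|A * P - 1| <= 1 / 2.
  rewrite -normc_real; move: h; congr (normc _ <= _).
  rewrite rmorphB rmorphM rmorph1 /A /P rmorph_sum rmorph_prod /=.
  by congr (_ * _ - _); apply: eq_bigr => p _; rewrite rmorphB rmorph1.
have A1 : A <= 1 + L.
  rewrite -[L]invrK (le_trans _ (sum_power_le X0' a0))//.
  rewrite /A big_mkcond ler_sum// => n _; case: ifP => // _; exact: damp_ge0.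
have PE : P <= expR (- \sum_(1 <= p < X.+1 | prime p) damp a p).
  rewrite -sumrN expR_sum; apply: ler_prod => p pp; rewrite expR_ge1Dx andbT subr_ge0.
  rewrite (le_trans (damp_le a0 _))// ?prime_gt0// invf_le1 ?ltr0n ?ler1n ?prime_gt0//.
set E := \sum_(1 <= p < X.+1 | prime p) damp a p in PE.
have E1 : \sum_(1 <= p < X.+1 | prime p) p%:R^-1 <= E + 2 * chebyshev_const R.
  rewrite -lerBlDl /E -sumrB.
  apply: (@le_trans _ _ (\sum_(1 <= p < X.+1 | prime p) a * (ln p%:R / p%:R))).
    by apply: ler_sum => p pp; rewrite inv_sub_damp ?prime_gt0.
  rewrite -mulr_sumr (le_trans (ler_wpM2l (ltW a0) (sum_ln_primes_div R X0)))//.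
  rewrite -/L mulrCA mulrC ler_wpM2r ?chebyshev_const_ge0//.
  by rewrite /a mulrC ler_pdivrMr//; lra.
apply: (@le_trans _ _ (expR E * expR (2 * chebyshev_const R))).
  by rewrite -expRD ler_expR.
rewrite /mertens_const mulrAC ler_wpM2r ?expR_ge0//.
move: h; rewrite ler_norml => /andP[h _].
have EP : expR E * P <= 1.
  by rewrite (le_trans (ler_wpM2l (expR_ge0 _) PE))// -expRD subrr expR0.
have := expR_gt0 E; set e := expR E in EP * => e0.
have : 0 <= A by rewrite sumr_ge0// => n _; exact: damp_ge0.
nra.
Qed.
(** The square of the distance from f to n^(it), see dist_sum_pdist. *)
Definition dist_sum f t X : R := \sum_(1 <= p < X.+1 | prime p)
  (1 - complex.Re (f p * (npow_it t p)^*)) / p%:R.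

Definition euler_const : R := 2 * (expR (chebyshev_const R * 2 + 4) * mertens_const).

Lemma euler_const_gt0 : 0 < euler_const.
Proof. by rewrite !mulr_gt0 ?expR_gt0. Qed.

(** The size of the Euler product is governed by the real parts of its
coefficients at the primes, which is what the distance to n^(it) measures. *)
Lemma smooth_dirichlet_bound X : 1 <= ln X%:R :> R -> exists X0,
  forall f t X', classF f -> (X0 <= X')%N ->
  normc (\sum_(1 <= n < X' | smooth X n)
           f n * (damp (ln X%:R)^-1 n)%:C * cis (- (t * ln n%:R))) <=
  euler_const * (ln X%:R * expR (- dist_sum f t X)).
Proof.
move=> L1; set L := ln X%:R in L1 *; have L0 : 0 < L by lra.
have X1 : (0 < X)%N by case: (X) @L L1 {L0} => //=; rewrite ln0// ler10.
pose a := L^-1; have a0 : 0 < a by rewrite invr_gt0.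
have [X0 h] := smooth_sum_euler_product X a0 ltr01.
exists X0 => f t X' [[f1 fM] fle] XX.
have nf n : (0 < n)%N -> normc (f n) <= 1.
  by move=> n0; have := fle n n0; rewrite normrC -(rmorph1 (real_complex R)) lecR.
pose G n := f n * (damp a n)%:C * cis (- (t * ln (n%:R : R))).
have nG n : (0 < n)%N -> normc (G n) <= damp a n.
  move=> n0; rewrite /G !normcM normc_cis mulr1 normc_real ger0_norm ?damp_ge0//.
  by rewrite ler_piMl ?damp_ge0 ?nf.
have mG : completely_multiplicative G.
  split=> [|m n m0 n0]; first by rewrite /G f1 damp1 ln1 mulr0 oppr0 cis0 !mulr1.
  rewrite /G fM// dampM// rmorphM /= natrM lnM ?posrE ?ltr0n// mulrDr opprD cisD; ring.
have {}h := h G mG nG _ XX.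
rewrite -/(G _) in h *; set A := \sum_(1 <= n < X' | smooth X n) _ in h *.
set P := \prod_(1 <= p < X.+1 | prime p) (1 - G p) in h.
have AP : normc A * normc P <= 2.
  rewrite -normcM; have -> : A * P = (A * P - 1) + 1 by ring.
  by rewrite (le_trans (le_normcD _ _))// normc1; lra.
have Gp2 p : prime p -> normc (G p) <= 1 / 2.
  move=> pp; rewrite (le_trans (nG _ (prime_gt0 pp)))// (le_trans (damp_le a0 (prime_gt0 pp)))//.
  by rewrite div1r lef_pV2 ?posrE ?ltr0n ?prime_gt0// ler_nat prime_gt1.
have P0 : 0 < normc P.
  rewrite normc_prod big_seq_cond prodr_gt0// => p /andP[_ pp].
  have := Gp2 p pp; have := le_normcD (1 - G p) (G p); rewrite subrK normc1; lra.
have PV : (normc P)^-1 <= expR (\sum_(1 <= p < X.+1 | prime p)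
     (complex.Re (G p) + 2 * normc (G p) ^+ 2)).
  rewrite normc_prod expR_sum -prodfV; apply: ler_prod => p pp.
  by rewrite invr_ge0 normc_ge0 inv_normc_1B// Gp2.
have ReG p : prime p -> complex.Re (G p) + 2 * normc (G p) ^+ 2 <=
    p%:R^-1 - (1 - complex.Re (f p * (npow_it t p)^*)) / p%:R +
    a * (ln p%:R / p%:R) + 2 * (p%:R^-1) ^+ 2.
  move=> pp; have p0 := prime_gt0 pp.
  apply: lerD; last first.
    rewrite ler_pM2l// ler_pXn2r ?nnegrE ?normc_ge0 ?invr_ge0//.
    by rewrite (le_trans (nG _ p0))// damp_le.
  have GE : G p = (damp a p)%:C * (f p * (npow_it t p)^*).
    by rewrite /G -conj_cis; ring.
  have -> : complex.Re (G p) = damp a p * complex.Re (f p * (npow_it t p)^*).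
    by rewrite GE; case: (f p * _) => x y /=; ring.
  set rho := complex.Re _.
  have rho1 : `|rho| <= 1.
    rewrite (le_trans (normr_Re_le _))// normcM /npow_it -/(cis _) conj_cis normc_cis mulr1.
    exact: nf.
  have := inv_sub_damp a p0; have := damp_le a0 p0; have := damp_ge0 a p.
  move: rho1; rewrite ler_norml => /andP[r1 r2].
  set d := damp a p; set i := p%:R^-1; set u := a * _; move=> d0 di diu.
  by rewrite (_ : i - (1 - rho) * i = rho * i); [nra | ring].
have sumE : \sum_(1 <= p < X.+1 | prime p) (complex.Re (G p) + 2 * normc (G p) ^+ 2) <=
    \sum_(1 <= p < X.+1 | prime p) p%:R^-1 - dist_sum f t X + (chebyshev_const R * 2 + 4).
  apply: (le_trans (ler_sum _ (fun p pp => ReG p pp))).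
  rewrite !big_split /= sumrN -!mulr_sumr -/(dist_sum f t X) -addrA lerD2l lerD//.
    rewrite (le_trans (ler_wpM2l (ltW a0) (sum_ln_primes_div R X1)))//.
    rewrite mulrCA ler_wpM2l ?chebyshev_const_ge0//.
    by rewrite -/L /a mulrC ler_pdivrMr//; lra.
  have -> : 4 = 2 * 2 :> R by ring.
  rewrite ler_pM2l// (le_trans _ (sum_inv_sqr_le R X.+1))//.
  by rewrite big_mkcond ler_sum// => p _; case: ifP => // _; rewrite sqr_ge0.
apply: (@le_trans _ _ (2 * (normc P)^-1)); first by rewrite ler_pdivlMr.
rewrite /euler_const -mulrA ler_pM2l// (le_trans PV)//.
apply: (@le_trans _ _ (expR (\sum_(1 <= p < X.+1 | prime p) p%:R^-1 - dist_sum f t X +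
  (chebyshev_const R * 2 + 4)))); first by rewrite ler_expR.
rewrite [leLHS]expRD mulrC (expRD _ (- dist_sum f t X)) -mulrA ler_pM2l ?expR_gt0//.
rewrite [leRHS]mulrA ler_pM2r ?expR_gt0//.
exact: sum_inv_primes.
Qed.
End DirichletSeriesBound.

(** * Logarithmic bins *)

Section LogarithmicBins.
Variable R : realType.
Implicit Types (L M T t : R) (f : nat -> R[i]) (n m j X Y N : nat).

Lemma expRN_mul1D (x : R) : expR (- x) * (1 + x) <= 1.
Proof.
rewrite -[leRHS](expRxMexpNx_1 x) [leRHS]mulrC ler_wpM2l ?expR_ge0//.
exact: expR_ge1Dx.
Qed.

Lemma expR_mul1B (x : R) : expR x * (1 - x) <= 1.
Proof. by have := expRN_mul1D (- x); rewrite opprK. Qed.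

(** Index of the bin of length 1 / L that contains ln n. *)
Definition bin L n : nat := Num.truncn (L * ln (n%:R : R)).

Lemma bin_itv L n : 0 < L -> (bin L n)%:R / L <= ln n%:R < (bin L n).+1%:R / L.
Proof.
move=> L0; rewrite ler_pdivrMr// ltr_pdivlMr// [ln _ * L]mulrC.
by apply: truncn_itv; rewrite mulr_ge0 ?ln_nat_ge0// ltW.
Qed.

Lemma bin_eqE L n j : 0 < L -> (bin L n == j) = (j%:R / L <= ln (n%:R : R) < j.+1%:R / L).
Proof.
move=> L0; rewrite ler_pdivrMr// ltr_pdivlMr// [ln _ * L]mulrC.
by rewrite truncn_eq ?mulr_ge0 ?ln_nat_ge0// ltW.
Qed.

Lemma sum_by_bins (V : nmodType) (F : nat -> nat -> V) (be : nat -> nat) Y K :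
  \sum_(0 <= i < K) \sum_(1 <= n < Y | be n == i) F n i =
  \sum_(1 <= n < Y | (be n < K)%N) F n (be n).
Proof.
under eq_bigr do rewrite big_mkcond; rewrite exchange_big /= [RHS]big_mkcond.
apply: eq_bigr => n _; case: ifP => h.
  rewrite (bigD1_seq (be n)) ?mem_index_iota ?iota_uniq//= eqxx big1 ?addr0// => i ni.
  by rewrite eq_sym (negbTE ni).
rewrite big_nat_cond big1// => i /andP[/andP[_ iK] _]; case: eqP => // e.
by rewrite e iK in h.
Qed.

(** The factor by which n^(-1 / L) shrinks from one bin to the next. *)
Definition decay L : R := expR (- L^-1 ^+ 2).

Lemma decay_gt0 L : 0 < decay L. Proof. exact: expR_gt0. Qed.

Lemma decayX L j : decay L ^+ j = expR (- L^-1 * (j%:R / L)).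
Proof. by rewrite /decay -expRM_natl; congr expR; ring. Qed.

Lemma decay_bounds L : 2 <= L ->
  [/\ 1 / 2 <= decay L, decay L < 1 & (1 - decay L ^+ 2)^-1 <= 2 * L ^+ 2].
Proof.
move=> L2; have L0 : 0 < L by lra.
have hL : L^-1 * L = 1 by rewrite mulVf// gt_eqF.
have h0 : 0 < L^-1 by rewrite invr_gt0.
have h2 : L^-1 <= 1 / 2 by clear - h0 hL L2; nra.
have hh : 0 < L^-1 ^+ 2 by rewrite exprn_gt0.
have hh4 : L^-1 ^+ 2 <= 1 / 4 by clear - h0 h2; nra.
have e1 : L^-1 ^+ 2 * L ^+ 2 = 1 by rewrite -exprMn hL expr1n.
have := expRN_mul1D (L^-1 ^+ 2); have := expR_ge1Dx (- L^-1 ^+ 2).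
rewrite -/(decay L); set q := decay L; set x := L^-1 ^+ 2 in hh hh4 e1 *.
move=> q1 q2; have ql : q < 1 by clear - q2 q1 hh hh4; nra.
split => //; first by clear - q1 hh4; lra.
rewrite -[leLHS]div1r ler_pdivrMr; last by clear - ql q1 hh4; nra.
have l0 := exprn_gt0 2 L0; set l := L ^+ 2 in e1 l0 *.
have : x <= 2 * (1 - q ^+ 2) by clear - q1 q2 hh hh4 ql; nra.
by clear - e1 l0; nra.
Qed.

Lemma bin_gap L n (l := ln (n%:R : R)) (d := l - (bin L n)%:R / L) : 0 < L ->
  [/\ 0 <= d, d <= L^-1 & decay L ^+ bin L n = expR (- L^-1 * l) * expR (L^-1 * d)].
Proof.
move=> L0; have /andP[j1 j2] := bin_itv n L0; split.
- by rewrite subr_ge0.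
- by rewrite lerBlDr; move: j2; rewrite -natr1 mulrDl mul1r addrC => /ltW.
by rewrite decayX -expRD; congr expR; rewrite /d; ring.
Qed.

Lemma expR_gap L d : 2 <= L -> 0 <= d <= L^-1 -> 1 <= expR (L^-1 * d) <= 1 + L^-1.
Proof.
move=> L2 /andP[d0 dh]; have L0 : 0 < L by lra.
have hL : L^-1 * L = 1 by rewrite mulVf// gt_eqF.
have h0 : 0 < L^-1 by rewrite invr_gt0.
have h2 : L^-1 <= 1 / 2 by clear - h0 hL L2; nra.
have := expR_mul1B (L^-1 * d); have := expR_ge1Dx (L^-1 * d).
have hd0 : 0 <= L^-1 * d by rewrite mulr_ge0// ltW.
have hd2 : L^-1 * d <= L^-1 * L^-1 by rewrite ler_pM2l.
set e := expR _; set x := L^-1 * d in hd0 hd2 *; set h := L^-1 in h0 h2 hd2 *.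
move=> e1 e2; apply/andP; split; first by clear - e1 hd0; lra.
have x2 : 0 < 1 - x by clear - hd2 h0 h2; nra.
rewrite -(ler_pM2r x2) (le_trans e2)//.
by clear - hd0 hd2 h0 h2; nra.
Qed.

Lemma decay_bin_le L n : 2 <= L -> decay L ^+ bin L n <= 2 * expR (- L^-1 * ln n%:R).
Proof.
move=> L2; have L0 : 0 < L by lra.
have [d0 dh ->] := bin_gap n L0; rewrite mulrC ler_wpM2r ?expR_ge0//.
have /andP[_] := expR_gap L2 (introT andP (conj d0 dh)).
have : L^-1 <= 1 by rewrite invf_le1//; lra.
by lra.
Qed.

(** Moving ln n to the left end of its bin changes the character n^(-it), damped,
by a relative error of order 1 / L, uniformly for |t| <= 1. *)
Lemma bin_character L t n : 2 <= L -> `|t| <= 1 ->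
  normc ((decay L)%:C ^+ bin L n * cis (- (t / L)) ^+ bin L n -
         (expR (- L^-1 * ln n%:R))%:C * cis (- (t * ln n%:R))) <=
  2 * L^-1 * expR (- L^-1 * ln n%:R).
Proof.
move=> L2 t1; have L0 : 0 < L by lra.
have [d0 dh qE] := bin_gap n L0.
have /andP[e1 e2] := expR_gap L2 (introT andP (conj d0 dh)).
set j := bin L n in d0 dh qE e1 e2 *; set l := ln (n%:R : R) in d0 dh qE e1 e2 *.
set E := expR (- L^-1 * l) in qE *; have E0 : 0 < E by exact: expR_gt0.
have -> : (decay L)%:C ^+ j * cis (- (t / L)) ^+ j - E%:C * cis (- (t * l)) =
    (decay L ^+ j - E)%:C * cis (- (t / L)) ^+ j +
    E%:C * (cis (- (t / L)) ^+ j - cis (- (t * l))).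
  by rewrite rmorphB rmorphXn mulrBl mulrBr addrA subrK.
rewrite (le_trans (le_normcD _ _))// !normcM normcX normc_cis expr1n mulr1 !normc_real.
rewrite qE (ger0_norm (ltW E0)).
rewrite [`|_ - E|]ger0_norm; last by rewrite subr_ge0 ler_peMr// ltW.
have : normc (cis (- (t / L)) ^+ j - cis (- (t * l))) <= L^-1.
  rewrite cisX (le_trans (normc_sub_cis _ _))//.
  have -> : j%:R * - (t / L) - - (t * l) = t * (l - j%:R / L) by ring.
  by rewrite normrM (ger0_norm d0) -[leRHS]mul1r ler_pM.
set v := normc _; set e0 := expR _ in e2 *; set h := L^-1 in e2 *.
by clear - E0 e2; nra.
Qed.

(** A bin that contains n has mass at most 2 / L + 1 / n, so that the squared masses
are dominated by the damped harmonic series divided by L and by the squares 1 / n^2. *)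
Lemma sum_sqr_bin_mass L (a : nat -> R[i]) N Y : 2 <= L ->
  (forall n, (0 < n)%N -> normc (a n) <= n%:R^-1) ->
  \sum_(0 <= j < N) decay L ^+ j.*2 * normc (\sum_(1 <= n < Y | bin L n == j) a n) ^+ 2 <= 8.
Proof.
move=> L2 na; have L0 : 0 < L by lra.
have [q2 q1 _] := decay_bounds L2; set q := decay L in q2 q1 *.
have q0 : 0 < q by exact: decay_gt0.
have h0 : 0 < L^-1 by rewrite invr_gt0.
pose w n := n%:R^-1 * (2 * L^-1 + n%:R^-1).
apply: (@le_trans _ _ (\sum_(0 <= j < N) \sum_(1 <= n < Y | bin L n == j) q ^+ j * w n)).
  apply: ler_sum => j _; rewrite -mulr_sumr -addnn exprD -mulrA ler_pM2l ?exprn_gt0//.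
  set bb := \sum_(1 <= n < Y | bin L n == j) (n%:R^-1 : R).
  have bb0 : 0 <= bb by rewrite sumr_ge0// => n _; rewrite invr_ge0.
  have nb : normc (\sum_(1 <= n < Y | bin L n == j) a n) <= bb.
    rewrite (le_trans (normc_sum _ _ _))// /bb [leLHS]big_nat_cond [leRHS]big_nat_cond.
    by apply: ler_sum => n /andP[/andP[n0 _] _]; exact: na.
  apply: (@le_trans _ _ (bb * bb)).
    rewrite (@le_trans _ _ (normc (\sum_(1 <= n < Y | bin L n == j) a n) ^+ 2))//.
      by rewrite ler_piMl ?sqr_ge0// exprn_ile1// ltW.
    by rewrite -expr2 ler_pXn2r ?nnegrE ?normc_ge0.
  rewrite {1}/bb mulr_suml [leLHS]big_nat_cond [leRHS]big_nat_cond.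
  apply: ler_sum => n /andP[/andP[n0 _] nj]; rewrite /w ler_wpM2l ?invr_ge0//.
  rewrite bin_eqE// in nj; have := sum_inv_window Y n0 nj.
  rewrite -(eq_bigl _ _ (fun m => bin_eqE m j L0)) -/bb.
  by rewrite -mulrBl -[j.+1%:R]natr1 addrAC subrr add0r mul1r.
rewrite (sum_by_bins (fun n j => q ^+ j * w n)).
apply: (@le_trans _ _ (\sum_(1 <= n < Y) (4 * L^-1 * damp L^-1 n + (n%:R^-1) ^+ 2))).
  rewrite big_mkcond [leLHS]big_nat_cond [leRHS]big_nat_cond.
  apply: ler_sum => n /andP[/andP[n0 _] _].
  have i0 : 0 <= n%:R^-1 :> R by rewrite invr_ge0.
  case: ifP => _; last by rewrite addr_ge0 ?sqr_ge0// !mulr_ge0 ?damp_ge0 ?(ltW h0).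
  have qj0 : 0 < q ^+ bin L n by rewrite exprn_gt0.
  have qj1 : q ^+ bin L n <= 1 by rewrite exprn_ile1// ltW.
  have : q ^+ bin L n * n%:R^-1 <= 2 * damp L^-1 n.
    by rewrite /damp mulrCA mulrC ler_wpM2l// decay_bin_le.
  rewrite /w; set x := q ^+ _ in qj0 qj1 *; set i := n%:R^-1 in i0 *.
  by set h := L^-1 in h0 *; set d := damp _ _; clear - i0 qj0 qj1 h0; nra.
rewrite big_split /= -mulr_sumr.
have := sum_inv_sqr_le R Y; set s := \sum_(1 <= i < Y) (_ ^+ 2).
have := sum_power_le Y h0; rewrite invrK -/(damp _ _); set s2 := \sum_(1 <= n < Y) _.
have : L^-1 * L = 1 by rewrite mulVf// gt_eqF.
by set h := L^-1 in h0 *; clear - h0 L2; nra.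
Qed.

(** The period N must exceed all bin indices in use, and be long enough for the damping
to defeat the trivial bound for the partial sums. *)
Lemma large_period L Y : 2 <= L -> exists N, [/\ (0 < N)%N, 2 * L ^+ 2 <= N%:R :> R,
  forall n, (n < Y)%N -> (bin L n < N)%N & decay L ^+ N * (3 + ln Y%:R) <= 1].
Proof.
move=> L2; have L0 : 0 < L by lra.
have lY := ln_nat_ge0 R Y.
exists (Num.truncn (L ^+ 2 * (2 + ln (Y%:R : R)))).+1.
have := truncnS_gt (L ^+ 2 * (2 + ln (Y%:R : R))).
set N := (Num.truncn _).+1 => NL; split=> //.
- rewrite (le_trans _ (ltW NL))//; have := sqr_ge0 L; set l := ln _ in lY *.
  by clear - lY; nra.
- move=> n nY; rewrite -(ltr_nat R) (le_lt_trans _ NL)//.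
  have lnY : ln (n%:R : R) <= ln Y%:R.
    case: n nY => [|n] nY; first by rewrite ln0.
    by apply: ler_lnn => //; exact: ltnW.
  have /andP[bn _] := bin_itv n L0; rewrite ler_pdivrMr// in bn.
  rewrite (le_trans bn)//; move: lnY lY; set l := ln n%:R; set w := ln Y%:R => lw w0.
  apply: (@le_trans _ _ (w * L)); first by rewrite ler_pM2r.
  have : w * L <= w * L ^+ 2 by rewrite ler_wpM2l//; clear - L2; nra.
  by clear - w0 L2; nra.
rewrite decayX mulNr (le_trans _ (expRN_mul1D (L^-1 * (N%:R / L))))// ler_pM2l ?expR_gt0//.
have -> : L^-1 * (N%:R / L) = N%:R / L ^+ 2 by field; rewrite gt_eqF.
have : 2 + ln Y%:R < N%:R / L ^+ 2 by rewrite ltr_pdivlMr ?exprn_gt0// mulrC.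
by set z := N%:R / _; set w := ln _; clear; lra.
Qed.

Definition smooth_part X f n : R[i] := if smooth X n then f n else 0.

Definition bin_partial_sum X f Y j : R[i] :=
  \sum_(1 <= n < Y | (bin (ln X%:R) n <= j)%N) smooth_part X f n * (n%:R^-1)%:C.

Definition mean_square_const : R := expR 4 * (8 * (euler_const R + 4) ^+ 2 + 48 ^+ 2).

Lemma mean_square_const_gt0 : 0 < mean_square_const.
Proof.
apply: mulr_gt0; first exact: expR_gt0.
apply: ltr_wpDl; last by rewrite exprn_gt0// ltr0n.
by rewrite mulr_ge0 ?ler0n// sqr_ge0.
Qed.

(** The frequency phi of the cyclic group corresponds to the imaginary part - phi L of
the argument of the Dirichlet series, and 1 - z is at most T / (4 L) in modulus only
if this imaginary part is at most T.  The other roots of unity contribute O(L^2 / T^2),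
because the squared bin sums have bounded total.  The integers below Y stand in for
all integers: Y only has to exceed X and to be large enough for the Euler product.  For
j <= 2 L^2 the damping has not yet fallen below a constant, and can be removed. *)
Lemma mean_square_bin_sums X f T M : 2 <= ln X%:R :> R -> classF f -> 0 < T <= 1 ->
  0 <= M -> (forall t, `|t| <= T -> ln X%:R * expR (- dist_sum f t X) <= M) ->
  exists2 Y, (X < Y)%N & forall J, J%:R <= 2 * ln X%:R ^+ 2 :> R ->
  \sum_(0 <= j < J) normc (bin_partial_sum X f Y j) ^+ 2 <=
    mean_square_const * (ln X%:R * (M + T^-1)) ^+ 2.
Proof.
move=> L2 fF /andP[T0 T1] M0 hM; rewrite /bin_partial_sum.
set L := ln (X%:R : R) in L2 hM *; have L0 : 0 < L by lra.
have [X0 dir] := @smooth_dirichlet_bound R X ltac:(rewrite -/L; lra).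
rewrite -/L in dir.
have h0 : 0 < L^-1 by rewrite invr_gt0.
have hL : L^-1 * L = 1 by rewrite mulVf// gt_eqF.
pose Y := maxn X0 X.+1; exists Y; first by rewrite /Y leq_max leqnn orbT.
move=> J J2; pose q := decay L.
have [N [N0 NL beN qN]] := large_period Y L2.
have [q2 q1 qi] := decay_bounds L2; rewrite -/q in q2 q1 qi qN.
have q0 : 0 < q by lra.
have NJ : (J <= N)%N by rewrite -(ler_nat R) (le_trans J2).
have lY := ln_nat_ge0 R Y.
have qN0 : 0 < q ^+ N by rewrite exprn_gt0.
pose a n := smooth_part X f n * (n%:R^-1)%:C.
have na n : (0 < n)%N -> normc (a n) <= n%:R^-1.
  move=> n0; rewrite /a normcM normc_real ger0_norm ?invr_ge0//.
  rewrite ler_piMl ?invr_ge0// /smooth_part; case: ifP => _; last by rewrite normc0.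
  by have := fF.2 n n0; rewrite normrC -(rmorph1 (real_complex R)) lecR.
pose b j := \sum_(1 <= n < Y | bin L n == j) a n.
have bS j : \sum_(0 <= i < j.+1) b i = \sum_(1 <= n < Y | (bin L n <= j)%N) a n.
  exact: (sum_by_bins (fun n _ => a n)).
(* A root of unity at distance del from 1 has an argument of size at most 4 del = T / L. *)
pose del := T / (4 * L).
have del0 : 0 < del by rewrite divr_gt0// mulr_gt0.
have tail : q ^+ N * normc (\sum_(0 <= j < N) b j) <= 1.
  apply: le_trans qN; rewrite ler_pM2l//.
  have -> : \sum_(0 <= j < N) b j = \sum_(1 <= n < Y | (bin L n < N)%N) a n.
    exact: (sum_by_bins (fun n _ => a n)).
  apply: (@le_trans _ _ (\sum_(1 <= n < Y) n%:R^-1)).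
    rewrite (le_trans (normc_sum _ _ _))// big_mkcond [leLHS]big_nat_cond [leRHS]big_nat_cond.
    by apply: ler_sum => n /andP[/andP[n0 _] _]; case: ifP => _; rewrite ?na// invr_ge0.
  have h3 : \sum_(1 <= n < Y) n%:R^-1 <= \sum_(1 <= n < Y.+1) n%:R^-1 :> R.
    exact: (sum_nat_widen (leqnSn Y)).
  by have := le_trans h3 (@sum_inv_le R Y); set w := ln _; lra.
(* On the near frequencies, the transform of the bin sums is compared with the series. *)
have near r : (r < N)%N -> normc (1 - cis (freq R N r)) <= del ->
    normc (dft N (fun j => q%:C ^+ j * b j) r) <= euler_const R * M + 3.
  move=> rN /(small_argument N0 rN)[phi phi1 e].
  rewrite /dft e.
  pose th := - (phi * L).
  have phiE : phi = - (th / L) by rewrite /th mulNr opprK mulfK// gt_eqF.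
  have thT : `|th| <= T.
    rewrite normrN normrM (gtr0_norm L0) -ler_pdivlMr// (le_trans phi1)//.
    by rewrite /del le_eqVlt; apply/orP; left; apply/eqP; field; rewrite gt_eqF.
  have -> : \sum_(0 <= j < N) q%:C ^+ j * b j * cis phi ^+ j =
      \sum_(1 <= n < Y) a n * (q%:C ^+ bin L n * cis phi ^+ bin L n).
    transitivity (\sum_(0 <= j < N) \sum_(1 <= n < Y | bin L n == j)
        a n * (q%:C ^+ j * cis phi ^+ j)).
      by apply: eq_bigr => j _; rewrite mulrAC mulrC mulr_suml.
    rewrite (sum_by_bins (fun n j => a n * (q%:C ^+ j * cis phi ^+ j))).
    rewrite big_nat_cond [RHS]big_nat_cond; apply: eq_bigl => n.
    by case: (ltnP n Y) => [/beN ->|]; rewrite ?andbT ?andbF.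
  set S := \sum_(1 <= n < Y) _.
  pose D := \sum_(1 <= n < Y) a n * ((expR (- L^-1 * ln n%:R))%:C * cis (- (th * ln (n%:R : R)))).
  have nD : normc D <= euler_const R * M.
    apply: (@le_trans _ _ (euler_const R * (L * expR (- dist_sum f th X)))); last first.
      by rewrite ler_pM2l ?euler_const_gt0// hM.
    apply: le_trans (dir f th Y fF (leq_maxl _ _)); rewrite /D [X in _ <= normc X]big_mkcond /=.
    rewrite le_eqVlt; apply/orP; left; apply/eqP; congr (normc _).
    apply: eq_bigr => n _; rewrite /a /smooth_part; case: ifP => _; last by rewrite !mul0r.
    by rewrite /damp rmorphM /=; ring.
  have nSD : normc (S - D) <= 3.
    rewrite /S /D -sumrB (le_trans (normc_sum _ _ _))//.
    apply: (@le_trans _ _ (2 * L^-1 * \sum_(1 <= n < Y) damp L^-1 n)); last first.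
      have := sum_power_le Y h0; rewrite invrK -/(damp _ _); set s2 := \sum_(1 <= n < Y) _.
      by move: hL; set h := L^-1 in h0 *; clear - h0 L2; nra.
    rewrite mulr_sumr [leLHS]big_nat_cond [leRHS]big_nat_cond.
    apply: ler_sum => n /andP[/andP[n0 _] _].
    rewrite -mulrBr normcM /damp mulrCA; apply: ler_pM; rewrite ?normc_ge0 ?na// phiE.
    by apply: bin_character => //; exact: le_trans T1.
  have -> : S = D + (S - D) by ring.
  by rewrite (le_trans (le_normcD _ _))// lerD.
have meanB : \sum_(0 <= j < N) q ^+ j.*2 * normc (b j) ^+ 2 <= 8 by exact: sum_sqr_bin_mass.
have c0 := euler_const_gt0 R; set c := euler_const R in near c0.
have A0 : 0 <= c * M + 3 by rewrite addr_ge0// mulr_ge0// ltW.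
have qN2 : q ^+ N <= 1 / 2.
  by move: qN lY qN0; set w := ln _; set z := q ^+ N; clear; nra.
have q12 : 1 / 2 <= q < 1 by rewrite q2.
have := partial_sums_mean_square N0 q12 qN2 del0 A0 tail near meanB.
under eq_bigr do rewrite bS.
move=> main.
apply: (@le_trans _ _ (expR 4 * \sum_(0 <= j < N) q ^+ j.*2 *
    normc (\sum_(1 <= n < Y | (bin L n <= j)%N) a n) ^+ 2)).
  apply: (@le_trans _ _ (\sum_(0 <= j < J) expR 4 * (q ^+ j.*2 *
    normc (\sum_(1 <= n < Y | (bin L n <= j)%N) a n) ^+ 2))).
    rewrite [leLHS]big_nat_cond [leRHS]big_nat_cond.
    apply: ler_sum => j /andP[/andP[_ jJ] _]; rewrite mulrA ler_peMl ?sqr_ge0//.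
    rewrite /q decayX -expRD -[leLHS]expR0 ler_expR.
    have : j%:R <= 2 * L ^+ 2 by rewrite (le_trans _ J2)// ler_nat ltnW.
    have -> : - L^-1 * (j.*2%:R / L) = - 2 * (j%:R / L ^+ 2).
      by rewrite -muln2 natrM; field; rewrite gt_eqF.
    by rewrite -ler_pdivrMr ?exprn_gt0//; set z := _ / _; clear; lra.
  rewrite -mulr_sumr ler_pM2l ?expR_gt0// [leRHS](big_cat_nat _ (n := J))//= lerDl sumr_ge0// => j _.
  by rewrite mulr_ge0 ?sqr_ge0// exprn_ge0// ltW.
rewrite /mean_square_const -mulrA ler_pM2l ?expR_gt0// (le_trans main)//.
have i2 : (del ^+ 2)^-1 = 16 * L ^+ 2 * (T^-1) ^+ 2.
  by rewrite /del; field; rewrite !gt_eqF.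
have Ti : 1 <= T^-1 by rewrite -[leRHS]div1r ler_pdivlMr// mul1r.
rewrite -/c i2; set Ti' := T^-1 in Ti *.
have AM : c * M + 3 + 1 <= (c + 4) * (M + Ti') by clear - c0 M0 Ti; nra.
have AM2 : (c * M + 3 + 1) ^+ 2 <= ((c + 4) * (M + Ti')) ^+ 2.
  by rewrite ler_pXn2r ?nnegrE//; clear - c0 M0 Ti A0 AM; lra.
apply: (@le_trans _ _ (4 * ((c + 4) * (M + Ti')) ^+ 2 * (2 * L ^+ 2) +
    16 * (8 + 1) * (16 * L ^+ 2 * Ti' ^+ 2))).
  rewrite lerD2r//; apply: ler_pM => //.
  - by rewrite mulr_ge0// sqr_ge0.
  - by rewrite invr_ge0; clear - q1 q0; nra.
  by rewrite ler_pM2l.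
have TM : Ti' ^+ 2 <= (M + Ti') ^+ 2.
  by rewrite ler_pXn2r ?nnegrE//; clear - M0 Ti; lra.
rewrite !exprMn; have := exprn_gt0 2 L0.
set w := (M + Ti') ^+ 2 in TM *; set s := L ^+ 2; set z := Ti' ^+ 2 in TM *.
by set d := (c + 4) ^+ 2; clear - TM; nra.
Qed.
End LogarithmicBins.

(** * Logarithmic means *)

Section LogarithmicMean.
Variable R : realType.
Implicit Types (L M T t u l : R) (f : nat -> R[i]) (n m j p X Y : nat).

Lemma ln_logn_sum n X : (0 < n)%N -> (n <= X)%N ->
  ln n%:R = \sum_(1 <= p < X.+1 | prime p) (logn p n)%:R * ln p%:R :> R.
Proof.
move=> n0 nX; have e : n = (\prod_(1 <= p < X.+1 | prime p) p ^ logn p n)%N.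
  rewrite -{1}(partnT n0) (widen_partn _ nX) big_mkcond big_ltn//= lognE /= mul1n.
  rewrite big_mkcond [RHS]big_mkcond; apply: eq_bigr => p _ /=.
  by case: ifP => // pp; rewrite lognE pp.
rewrite {1}e natr_prod -[RHS]expRK expR_sum; congr ln.
apply: eq_bigr => p pp; rewrite expRM_natl lnK ?natrX// posrE ltr0n prime_gt0//.
Qed.

(** A multiple p m of the prime p is counted once for p, and then as often as m. *)
Lemma logn_weighted_rec (K : comPzRingType) (a : nat -> K) p X : prime p ->
  (forall m, (0 < m)%N -> a (p * m)%N = a p * a m) ->
  \sum_(1 <= n < X.+1) (logn p n)%:R * a n =
  a p * (\sum_(1 <= m < (X %/ p).+1) a m +
         \sum_(1 <= m < (X %/ p).+1) (logn p m)%:R * a m).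
Proof.
move=> pp aM.
transitivity (\sum_(1 <= n < X.+1 | (p %| n)%N) (logn p n)%:R * a n).
  rewrite [RHS]big_mkcond; apply: eq_bigr => n _; case: ifP => // pn.
  by rewrite lognE pp pn /= andbF mul0r.
rewrite sum_multiples ?prime_gt0// -big_split /= mulr_sumr.
apply: eq_big_nat => m /andP[m0 _].
have p0 := prime_gt0 pp; rewrite aM// lognM// (logn_prime _ pp) eqxx natrD /=; ring.
Qed.

(** The recursion for multiples of p bounds the sum W by (H + W) / p, where H is the
harmonic sum; as p >= 2, the term W / p can be absorbed. *)
Lemma sum_logn_inv_le p X : prime p ->
  \sum_(1 <= n < X.+1) (logn p n)%:R * n%:R^-1 <= 2 * (1 + ln X%:R) / p%:R :> R.
Proof.
move=> pp; have p0 := prime_gt0 pp.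
have XpX : (X %/ p <= X)%N by exact: leq_div.
have H := @sum_inv_le R X; have i0 : forall n, 0 <= n%:R^-1 :> R by move=> n; rewrite invr_ge0.
have := @logn_weighted_rec R (fun n => n%:R^-1) p X pp.
have aM m : (0 < m)%N -> (p * m)%:R^-1 = p%:R^-1 * m%:R^-1 :> R by rewrite natrM invfM.
move=> /(_ aM).
set W := \sum_(1 <= n < X.+1) _.
have W1 : \sum_(1 <= m < (X %/ p).+1) (logn p m)%:R * m%:R^-1 <= W.
  by apply: sum_nat_widen => // n _; rewrite mulr_ge0.
have H1 : \sum_(1 <= m < (X %/ p).+1) m%:R^-1 <= 1 + ln X%:R :> R.
  by apply: le_trans H; apply: sum_nat_widen.
have W0 : 0 <= W by rewrite sumr_ge0// => n _; rewrite mulr_ge0.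
have p2 : p%:R^-1 <= 1 / 2 :> R.
  by rewrite div1r lef_pV2 ?posrE ?ltr0n// ler_nat prime_gt1.
have := i0 p; set i := p%:R^-1 in p2 *.
move: W1 H1; set s1 := \sum_(1 <= m < _) _; set s2 := \sum_(1 <= m < _) m%:R^-1.
set l := ln X%:R; move=> W1 H1 ip WE.
have : i * (s2 + s1) <= i * ((1 + l) + W) by rewrite ler_wpM2l// lerD.
rewrite -WE mulrDr => h; have : i * W <= 1 / 2 * W by rewrite ler_wpM2r.
by move: h; clear; lra.
Qed.

Definition log_sum f m : R[i] := \sum_(1 <= n < m.+1) f n * (n%:R^-1)%:C.

Lemma classF_normc f n : classF f -> (0 < n)%N -> normc (f n) <= 1.
Proof.
by move=> fF n0; have := fF.2 n n0; rewrite normrC -(rmorph1 (real_complex R)) lecR.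
Qed.

Lemma classF_term_le f n : classF f -> (0 < n)%N -> normc (f n * (n%:R^-1)%:C) <= n%:R^-1.
Proof.
move=> fF n0; rewrite normcM normc_real ger0_norm ?invr_ge0//.
by rewrite ler_piMl ?invr_ge0// classF_normc.
Qed.

(** The part of ln n coming from one factor p of n reproduces the logarithmic sum at
X / p; the further factors p contribute a convergent sum over p. *)
Lemma sum_ln_weighted f X : classF f ->
  normc (\sum_(1 <= n < X.+1) f n * (n%:R^-1)%:C * (ln n%:R)%:C) <=
  \sum_(1 <= p < X.+1 | prime p) ln p%:R / p%:R * normc (log_sum f (X %/ p)) +
  12 * (1 + ln X%:R).
Proof.
move=> fF; pose a n : R[i] := f n * (n%:R^-1)%:C.
have aM p m : prime p -> (0 < m)%N -> a (p * m)%N = a p * a m.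
  move=> /prime_gt0 p0 m0; rewrite /a fF.1.2// natrM invfM rmorphM /=; ring.
have -> : \sum_(1 <= n < X.+1) f n * (n%:R^-1)%:C * (ln n%:R)%:C =
    \sum_(1 <= p < X.+1 | prime p) (ln p%:R)%:C * (a p * (log_sum f (X %/ p) +
       \sum_(1 <= m < (X %/ p).+1) (logn p m)%:R * a m)).
  transitivity (\sum_(1 <= n < X.+1) \sum_(1 <= p < X.+1 | prime p)
      (ln p%:R)%:C * ((logn p n)%:R * a n)).
    apply: eq_big_nat => n /andP[n0 nX]; rewrite (ln_logn_sum n0 nX) rmorph_sum mulr_sumr.
    by apply: eq_bigr => p pp; rewrite rmorphM /= rmorph_nat /a; ring.
  rewrite exchange_big /=; apply: eq_bigr => p pp.
  by rewrite -mulr_sumr (logn_weighted_rec X pp (fun m => aM p m pp)).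
rewrite (le_trans (normc_sum _ _ _))//.
apply: (@le_trans _ _ (\sum_(1 <= p < X.+1 | prime p) (ln p%:R / p%:R *
    normc (log_sum f (X %/ p)) + 2 * (1 + ln X%:R) * (ln p%:R / p%:R ^+ 2)))).
  apply: ler_sum => p pp; have p0 := prime_gt0 pp.
  rewrite normcM [normc (a p * _)]normcM normc_real ger0_norm ?ln_nat_ge0//.
  have h1 : normc (a p) <= p%:R^-1 by exact: classF_term_le.
  have h2 : normc (\sum_(1 <= m < (X %/ p).+1) (logn p m)%:R * a m) <=
      2 * (1 + ln X%:R) / p%:R.
    apply: le_trans (sum_logn_inv_le X pp).
    apply: (@le_trans _ _ (\sum_(1 <= m < (X %/ p).+1) (logn p m)%:R * m%:R^-1)).
      rewrite (le_trans (normc_sum _ _ _))//; apply: ler_sum_nat => m /andP[m0 _].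
      by rewrite normcM normc_nat ler_wpM2l// classF_term_le.
    apply: sum_nat_widen; first by rewrite ltnS leq_div.
    by move=> m _; rewrite mulr_ge0 ?invr_ge0.
  apply: (@le_trans _ _ (ln p%:R * (p%:R^-1 * (normc (log_sum f (X %/ p)) +
      2 * (1 + ln X%:R) / p%:R)))).
    rewrite ler_wpM2l ?ln_nat_ge0//; apply: ler_pM; rewrite ?normc_ge0//.
    by rewrite (le_trans (le_normcD _ _))// lerD2l.
  by rewrite le_eqVlt; apply/orP; left; apply/eqP; field; rewrite pnatr_eq0 -lt0n.
rewrite big_split /= lerD2l -mulr_sumr.
have c0 : 0 <= 2 * (1 + ln (X%:R : R)) by rewrite mulr_ge0// addr_ge0// ln_nat_ge0.
have := ler_wpM2l c0 (sum_ln_div_sqr R X.+1).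
rewrite (_ : _ * 6 = 12 * (1 + ln X%:R)); last by ring.
apply: le_trans; rewrite ler_wpM2l// big_mkcond ler_sum// => p _; case: ifP => // _.
by rewrite divr_ge0 ?ln_nat_ge0 ?exprn_ge0.
Qed.

(** The bins whose left ends exceed L - l by at most 1.  For l = ln p they average the
sum at X / p, and for a given bin the admissible ln p again fill a unit interval. *)
Definition unit_window L l j : bool := L - l <= j%:R / L <= L - l + 1.

(** The integers in the bins up to j that exceed X / p have their logarithms in an
interval of length 2, so that they contribute O(1). *)
Lemma log_sum_vs_bins f X Y p j : 2 <= ln X%:R :> R -> (X < Y)%N -> classF f ->
  (0 < p)%N ->
  unit_window (ln X%:R) (ln p%:R) j ->
  normc (log_sum f (X %/ p)) <= normc (bin_partial_sum X f Y j) + 5.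
Proof.
rewrite /log_sum /bin_partial_sum; set L := ln (X%:R : R).
move=> L2 XY fF p0 /andP[j1 j2]; have L0 : 0 < L by lra.
have X0 : (0 < X)%N by case: (X) @L L2 {L0 j1 j2} => //=; rewrite ln0// lern0.
have lnM n : (0 < n)%N -> ln ((n * p)%:R : R) = ln n%:R + ln p%:R.
  by move=> n0; rewrite natrM lnM ?posrE ?ltr0n.
set Z := (X %/ p).+1; have ZY : (Z <= Y)%N by rewrite /Z (leq_trans _ XY)// ltnS leq_div.
pose a n : R[i] := smooth_part X f n * (n%:R^-1)%:C.
have na n : (0 < n)%N -> normc (a n) <= n%:R^-1.
  move=> n0; rewrite /a /smooth_part; case: ifP => _; first exact: classF_term_le.
  by rewrite mul0r normc0 invr_ge0.
have -> : \sum_(1 <= n < Z) f n * (n%:R^-1)%:C = \sum_(1 <= n < Z | (bin L n <= j)%N) a n.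
  rewrite [RHS]big_mkcond; apply: eq_big_nat => n /andP[n0 nZ].
  have nX : (n * p <= X)%N by rewrite -leq_divRL// -ltnS.
  have -> : (bin L n <= j)%N.
    have /andP[bn _] := bin_itv n L0; rewrite -(ler_nat R) -(@ler_pM2r _ L^-1) ?invr_gt0//.
    rewrite (le_trans bn)// (le_trans _ j1)// lerBrDr -lnM//.
    by apply: ler_lnn; rewrite ?muln_gt0 ?n0.
  by rewrite /a /smooth_part smooth_le// (leq_trans _ nX)// leq_pmulr.
rewrite (big_cat_nat _ (n := Z) (p := Y))//=.
set S := \sum_(1 <= n < Z | _) _; set E := \sum_(Z <= n < Y | _) _.
have nE : normc E <= 5.
  rewrite (le_trans (normc_sum _ _ _))//.
  pose u := L - ln (p%:R : R).
  apply: (@le_trans _ _ (\sum_(1 <= n < Y | u <= ln (n%:R : R) < u + 2) n%:R^-1)); last first.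
    rewrite (le_trans (sum_inv_window1 Y _))//; first by lra.
    by rewrite addrAC subrr add0r; lra.
  rewrite [leRHS](big_cat_nat _ (n := Z))//=.
  rewrite -[leLHS]add0r lerD//; first by rewrite sumr_ge0// => n _; rewrite invr_ge0.
  rewrite [leLHS]big_mkcond [leRHS]big_mkcond; apply: ler_sum_nat => n /andP[Zn nY].
  have n0 : (0 < n)%N by exact: leq_trans Zn.
  case: ifP => bj; last by case: ifP => // _; rewrite invr_ge0.
  have -> : u <= ln (n%:R : R) < u + 2; last exact: na.
  apply/andP; split.
    rewrite lerBlDr -lnM//; apply: ler_lnn => //.
    by rewrite ltnW// -ltn_divLR.
  have /andP[_ bn] := bin_itv n L0; rewrite (lt_le_trans bn)//.
  apply: (@le_trans _ _ (j.+1%:R / L)); first by rewrite ler_pM2r ?invr_gt0// ler_nat ltnS.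
  rewrite -natr1 mulrDl mul1r; have : L^-1 <= 1 by rewrite invf_le1//; lra.
  by rewrite /u; lra.
have -> : S = (S + E) - E by rewrite addrK.
by rewrite (le_trans (normcB _ _))// addrK lerD2l.
Qed.

(** A unit window contains at least L / 2 bins, and the bound may be averaged over any
of them. *)
Lemma log_sum_average f X Y J p : 2 <= ln X%:R :> R -> (X < Y)%N -> classF f ->
  (0 < p)%N -> (p <= X)%N -> ln X%:R ^+ 2 + ln X%:R + 1 <= J%:R :> R ->
  normc (log_sum f (X %/ p)) <=
  2 / ln X%:R * (\sum_(0 <= j < J |
     unit_window (ln X%:R) (ln p%:R) j)
     normc (bin_partial_sum X f Y j)) + 5.
Proof.
move=> L2 XY fF p0 pX LJ.
have cmp j := @log_sum_vs_bins f X Y p j L2 XY fF p0.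
set L := ln (X%:R : R) in L2 LJ cmp *; have L0 : 0 < L by lra.
set s := normc (log_sum _ _) in cmp *; pose u := L - ln (p%:R : R).
have u0 : 0 <= u by rewrite subr_ge0 ler_lnn.
have uL : u <= L by rewrite gerBl ln_nat_ge0.
pose B j := normc (bin_partial_sum X f Y j).
have B0 j : 0 <= B j by exact: normc_ge0.
pose j0 := (Num.truncn (L * u)).+1; pose k := Num.truncn L.
have j0l : L * u < j0%:R by exact: truncnS_gt.
have j0u : j0%:R <= L * u + 1.
  by rewrite /j0 -natr1 lerD2r truncn_le mulr_ge0// ltW.
have kL : k%:R <= L by rewrite truncn_le ltW.
have Lk : L < k%:R + 1 by rewrite natr1; exact: truncnS_gt.
have k2 : L / 2 <= k%:R by lra.
have win j : (j0 <= j < j0 + k)%N -> unit_window L (ln p%:R) j.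
  move=> /andP[jl ju]; rewrite /unit_window -/u ler_pdivlMr// ler_pdivrMr//.
  have h1 : j0%:R <= j%:R :> R by rewrite ler_nat.
  have h2 : j%:R + 1 <= j0%:R + k%:R :> R by rewrite natr1 -natrD ler_nat.
  by apply/andP; split; lra.
have jkJ : (j0 + k <= J)%N.
  rewrite -(ler_nat R) natrD (le_trans _ LJ)//.
  have : L * u <= L ^+ 2 by rewrite expr2 ler_pM2l.
  lra.
have key : s *+ k <= \sum_(0 <= j < J | unit_window L (ln p%:R) j) B j + 5 *+ k.
  have -> : s *+ k = \sum_(j0 <= j < j0 + k) s by rewrite sumr_const_nat addKn.
  have -> : 5 *+ k = \sum_(j0 <= j < j0 + k) (5 : R) by rewrite sumr_const_nat addKn.
  apply: (@le_trans _ _ (\sum_(j0 <= j < j0 + k) (B j + 5))).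
    by apply: ler_sum_nat => j jw; exact: cmp (win j jw).
  rewrite big_split /= lerD2r//.
  rewrite [leRHS](big_cat_nat _ (n := j0 + k))//= [X in _ <= X + _](big_cat_nat _ (n := j0))//=; last first.
    exact: leq_addr.
  rewrite -addrA addrCA -[leLHS]addr0 lerD//; last by rewrite addr_ge0// sumr_ge0.
  rewrite [leRHS]big_mkcond; apply: ler_sum_nat => j jw; rewrite win//.
move: key; rewrite -/(B _) -[s *+ k]mulr_natr -[5 *+ k]mulr_natr.
set SB := \sum_(0 <= j < J | _) _.
have SB0 : 0 <= SB by rewrite sumr_ge0.
have s0 : 0 <= s by exact: normc_ge0.
move=> key; have [s5|s5] := leP s 5.
  by rewrite (le_trans s5)// lerDr mulr_ge0// divr_ge0// ltW.
rewrite -lerBlDr -(@ler_pM2r _ (L / 2)) ?divr_gt0//.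
have -> : 2 / L * SB * (L / 2) = SB by field; rewrite gt_eqF.
apply: (@le_trans _ _ ((s - 5) * k%:R)); first by rewrite ler_wpM2l// subr_ge0 ltW.
by rewrite mulrBl lerBlDr.
Qed.

(** After exchanging the sums over p and over bins, each bin carries the weight of the
primes in one unit window, which Chebyshev's estimate bounds uniformly. *)
Lemma sum_ln_primes_log_sum_le f X Y J : 2 <= ln X%:R :> R -> (X < Y)%N -> classF f ->
  ln X%:R ^+ 2 + ln X%:R + 1 <= J%:R :> R ->
  \sum_(1 <= p < X.+1 | prime p) ln p%:R / p%:R * normc (log_sum f (X %/ p)) <=
  2 / ln X%:R * chebyshev_const R *
    \sum_(0 <= j < J) normc (bin_partial_sum X f Y j) +
  5 * (chebyshev_const R * (ln X%:R + 1)).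
Proof.
move=> L2 XY fF LJ.
have X0 : (0 < X)%N by case: (X) L2 => //=; rewrite ln0// lern0.
have av p := @log_sum_average f X Y J p L2 XY fF.
pose B j := normc (bin_partial_sum X f Y j).
have B0 j : 0 <= B j by exact: normc_ge0.
set L := ln (X%:R : R) in L2 LJ av *; have L0 : 0 < L by lra.
pose w j p := unit_window L (ln p%:R) j.
apply: (@le_trans _ _ (\sum_(1 <= p < X.+1 | prime p) (2 / L * (ln p%:R / p%:R *
    \sum_(0 <= j < J | w j p) B j) + 5 * (ln p%:R / p%:R)))).
  rewrite big_nat_cond [leRHS]big_nat_cond; apply: ler_sum => p /andP[/andP[p0 pX] _].
  have lp0 : 0 <= ln p%:R / p%:R :> R by rewrite divr_ge0 ?ln_nat_ge0.
  rewrite (le_trans (ler_wpM2l lp0 (av p p0 _ LJ)))//.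
  by rewrite le_eqVlt; apply/orP; left; apply/eqP; rewrite -/(w _ _); ring.
rewrite big_split /= -!mulr_sumr lerD//; last by rewrite ler_pM2l// sum_ln_primes_div.
rewrite -mulrA ler_pM2l ?divr_gt0//.
have -> : \sum_(1 <= p < X.+1 | prime p) ln p%:R / p%:R * \sum_(0 <= j < J | w j p) B j =
    \sum_(0 <= j < J) (\sum_(1 <= p < X.+1 | prime p && w j p) ln p%:R / p%:R) * B j.
  under eq_bigr do rewrite big_mkcond mulr_sumr.
  rewrite exchange_big /=; apply: eq_bigr => j _; rewrite mulr_suml.
  rewrite [RHS]big_mkcondr; apply: eq_bigr => p _ /=; case: ifP => _ //.
  by rewrite mulr0.
rewrite mulr_sumr; apply: ler_sum => j _; rewrite ler_wpM2r//.
rewrite (eq_bigl (fun p => prime p && (L - j%:R / L <= ln (p%:R : R) <= L - j%:R / L + 1))).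
  exact: sum_ln_primes_window.
move=> p; rewrite /w /unit_window; congr (_ && _); set l := ln _; set z := _ / _.
by apply/andP/andP => -[h1 h2]; split; lra.
Qed.

(** Up to an error 1 / L, the weight ln X - ln n is 1 / L times the number of bins between
n and X, that is, the number of bin partial sums that count n before reaching X. *)
Lemma sum_ln_complement_le f X Y J : 2 <= ln X%:R :> R -> (X < Y)%N -> classF f ->
  ln X%:R ^+ 2 + ln X%:R + 1 <= J%:R :> R ->
  normc (\sum_(1 <= n < X.+1) f n * (n%:R^-1)%:C * (ln X%:R - ln n%:R)%:C) <=
  1 / ln X%:R * \sum_(0 <= j < J) normc (bin_partial_sum X f Y j) + 2.
Proof.
move=> L2 XY fF LJ.
have X0 : (0 < X)%N by case: (X) L2 => //=; rewrite ln0// lern0.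
pose B j := bin_partial_sum X f Y j.
rewrite /bin_partial_sum; set L := ln (X%:R : R) in L2 LJ *; have L0 : 0 < L by lra.
pose J1 := bin L X.
have J1J : (J1 <= J)%N.
  rewrite -(ler_nat R) (le_trans _ LJ)//.
  have /andP[+ _] := bin_itv X L0; rewrite -/J1 -/L ler_pdivrMr//.
  by set z := J1%:R; clear - L0; nra.
pose a n : R[i] := smooth_part X f n * (n%:R^-1)%:C.
have sumB : \sum_(0 <= j < J1) \sum_(1 <= n < Y | (bin L n <= j)%N) a n =
    \sum_(1 <= n < X.+1) (J1 - bin L n)%:R * a n.
  under eq_bigr do rewrite big_mkcond.
  rewrite exchange_big /= (big_cat_nat _ (n := X.+1))//=.
  rewrite [X in _ + X]big_nat_cond [X in _ + X]big1 ?addr0 => [|n /andP[/andP[Xn _] _]].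
    apply: eq_big_nat => n /andP[n0 nX].
    have bJ : (bin L n <= J1)%N by rewrite le_truncn// ler_pM2l// ler_lnn.
    rewrite (big_cat_nat _ (n := bin L n))//= big_nat_cond big1 ?add0r; last first.
      by move=> j /andP[/andP[_ jb] _]; rewrite leqNgt jb.
    rewrite (eq_big_nat _ _ (F2 := fun=> a n)); last by move=> j /andP[-> _].
    by rewrite sumr_const_nat mulr_natl.
  rewrite big_nat_cond big1// => j /andP[/andP[_ jJ] _]; case: ifP => // bj.
  have : (J1 <= bin L n)%N by rewrite le_truncn// ler_pM2l// ler_lnn// ltnW.
  by lia.
have aE n : (0 < n)%N -> (n <= X)%N -> a n = f n * (n%:R^-1)%:C.
  by move=> n0 nX; rewrite /a /smooth_part smooth_le.
set S := \sum_(1 <= n < X.+1) _.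
have diff : normc (S - (L^-1)%:C *
    \sum_(0 <= j < J1) \sum_(1 <= n < Y | (bin L n <= j)%N) a n) <= 2.
  rewrite sumB mulr_sumr -sumrB (le_trans (normc_sum _ _ _))//.
  apply: (@le_trans _ _ (\sum_(1 <= n < X.+1) L^-1 * n%:R^-1)).
    apply: ler_sum_nat => n /andP[n0 nX].
    have bJ : (bin L n <= J1)%N by rewrite le_truncn// ler_pM2l// ler_lnn.
    rewrite -aE//.
    have -> : a n * (L - ln n%:R)%:C - (L^-1)%:C * ((J1 - bin L n)%:R * a n) =
        (L - ln n%:R - L^-1 * (J1 - bin L n)%:R)%:C * a n.
      by rewrite [in RHS]rmorphB rmorphM /= rmorph_nat; ring.
    rewrite normcM normc_real; apply: ler_pM; rewrite ?normc_ge0//; last first.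
      by rewrite aE// classF_term_le.
    have /andP[x1 x2] := bin_itv X L0; have /andP[y1 y2] := bin_itv n L0.
    rewrite -/J1 -/L in x1 x2; rewrite natrB// mulrBr ![L^-1 * _]mulrC.
    move: x2 y2; rewrite -!natr1 !mulrDl !mul1r => x2 y2.
    rewrite ler_norml; apply/andP; move: x1 x2 y1 y2.
    set x := J1%:R / L; set y := _ / L; set l := ln n%:R; set h := L^-1.
    by clear; move=> x1 x2 y1 y2; split; lra.
  rewrite -mulr_sumr (le_trans (ler_wpM2l _ (@sum_inv_le R X)))//.
    by rewrite invr_ge0 ltW.
  by rewrite mulrC ler_pdivrMr// -/L; lra.
have -> : S = (L^-1)%:C * \sum_(0 <= j < J1) \sum_(1 <= n < Y | (bin L n <= j)%N) a n +
  (S - (L^-1)%:C * \sum_(0 <= j < J1) \sum_(1 <= n < Y | (bin L n <= j)%N) a n) by ring.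
rewrite (le_trans (le_normcD _ _))// lerD// normcM normc_real gtr0_norm ?invr_gt0//.
rewrite div1r ler_pM2l ?invr_gt0// (le_trans (normc_sum _ _ _))//.
rewrite [leRHS](big_cat_nat _ (n := J1))//= lerDl sumr_ge0// => j _; exact: normc_ge0.
Qed.

Definition halasz_const : R :=
  (mean_square_const R / 2 + 1) * (1 + 2 * chebyshev_const R) + 10 * chebyshev_const R + 26.

Lemma halasz_const_ge3 : 3 <= halasz_const.
Proof.
have := mean_square_const_gt0 R; have := chebyshev_const_ge0 R; rewrite /halasz_const.
by set c := chebyshev_const R; set m := mean_square_const R; nra.
Qed.

(** Multiplying by ln X = ln n + ln (X / n) turns the sum into averages of the bin partial
sums, to which the mean square bound applies. *)
Lemma log_sum_le_large f X T M : 2 <= ln X%:R :> R -> classF f -> 0 < T <= 1 ->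
  0 <= M -> (forall t, `|t| <= T -> ln X%:R * expR (- dist_sum f t X) <= M) ->
  normc (log_sum f X) <= halasz_const * (M + T^-1).
Proof.
move=> L2 fF T01 M0 hM; have [Y XY ms] := mean_square_bin_sums L2 fF T01 M0 hM.
have T1 : 1 <= T^-1 by case/andP: T01 => T0 T1; rewrite -[leRHS]div1r ler_pdivlMr// mul1r.
have fej J := @sum_ln_complement_le f X Y J L2 XY fF.
have pri J := @sum_ln_primes_log_sum_le f X Y J L2 XY fF.
have lnw := sum_ln_weighted X fF.
set L := ln (X%:R : R) in L2 ms fej pri lnw *; have L0 : 0 < L by lra.
set K := M + T^-1 in ms *; have K1 : 1 <= K by rewrite /K; lra.
pose J := (Num.truncn (L ^+ 2 + L + 1)).+1.
have LJ : L ^+ 2 + L + 1 <= J%:R by apply/ltW; exact: truncnS_gt.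
have JL : J%:R <= 2 * L ^+ 2.
  have : (Num.truncn (L ^+ 2 + L + 1))%:R <= L ^+ 2 + L + 1.
    by rewrite truncn_le; clear - L2; nra.
  by rewrite /J -natr1; set z := (Num.truncn _)%:R; clear - L2; nra.
have {}ms := ms J JL; have {}fej := fej J LJ; have {}pri := pri J LJ.
pose B j := normc (bin_partial_sum X f Y j).
set m2 := mean_square_const R in ms; have m20 : 0 < m2 by exact: mean_square_const_gt0.
(* Cauchy-Schwarz in the form 2 b <= b^2 / K + K, with K of the expected size of B. *)
have SB : \sum_(0 <= j < J) B j <= L ^+ 2 * K * (m2 / 2 + 1).
  have amgm j : B j <= (2 * K)^-1 * B j ^+ 2 + K / 2.
    have := sqr_ge0 (B j - K); rewrite sqrrB => h.
    have -> : (2 * K)^-1 * B j ^+ 2 + K / 2 = (B j ^+ 2 + K ^+ 2) / (2 * K).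
      by field; rewrite gt_eqF//; clear - K1; lra.
    rewrite ler_pdivlMr; last by clear - K1; lra.
    by move: h; rewrite mulr2n; set b := B j; clear; lra.
  rewrite (le_trans (ler_sum _ (fun j _ => amgm j)))// big_split /= -mulr_sumr sumr_const_nat subn0.
  rewrite -[K / 2 *+ J]mulr_natr.
  have i0 : 0 <= (2 * K)^-1 by rewrite invr_ge0; clear - K1; lra.
  apply: (@le_trans _ _ ((2 * K)^-1 * (m2 * (L * K) ^+ 2) + K / 2 * (2 * L ^+ 2))).
    apply: lerD; first by rewrite ler_wpM2l.
    by rewrite ler_wpM2l//; clear - K1; lra.
  by rewrite le_eqVlt; apply/orP; left; apply/eqP; field; rewrite gt_eqF//; clear - K1; lra.
set c := chebyshev_const R in pri; have c0 : 0 <= c by exact: chebyshev_const_ge0.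
move: fej pri SB; rewrite /B; set SS := \sum_(0 <= j < J) _ => fej pri SB.
have decomp : L%:C * log_sum f X =
    \sum_(1 <= n < X.+1) f n * (n%:R^-1)%:C * (L - ln n%:R)%:C +
    \sum_(1 <= n < X.+1) f n * (n%:R^-1)%:C * (ln n%:R)%:C.
  rewrite -big_split /= /log_sum mulr_sumr; apply: eq_bigr => n _.
  by rewrite -mulrDr -rmorphD subrK mulrC.
have : L * normc (log_sum f X) <= 1 / L * SS + 2 + (2 / L * c * SS +
    5 * (c * (L + 1)) + 12 * (1 + L)).
  rewrite -{1}(gtr0_norm L0) -(normc_real L) -normcM decomp.
  rewrite (le_trans (le_normcD _ _))// lerD// (le_trans lnw)// lerD2r//.
set s := normc _ => h.
have SL : SS / L <= L * K * (m2 / 2 + 1).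
  by rewrite ler_pdivrMr// (le_trans SB)// le_eqVlt; apply/orP; left; apply/eqP; ring.
rewrite -(ler_pM2l L0) (le_trans h)//.
have -> : 1 / L * SS + 2 + (2 / L * c * SS + 5 * (c * (L + 1)) + 12 * (1 + L)) =
  (SS / L) * (1 + 2 * c) + 2 + 5 * c * (L + 1) + 12 * (1 + L) by ring.
have h1 : (SS / L) * (1 + 2 * c) <= L * K * (m2 / 2 + 1) * (1 + 2 * c).
  by rewrite ler_wpM2r//; clear - c0; lra.
have LK : L <= L * K by rewrite ler_peMr// ltW.
have h2 : 5 * c * (L + 1) <= 10 * c * (L * K).
  have : c * (L + 1) <= c * (2 * (L * K)) by rewrite ler_wpM2l//; clear - LK L2; lra.
  by clear; lra.
rewrite /halasz_const -/c -/m2.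
have -> : L * (((m2 / 2 + 1) * (1 + 2 * c) + 10 * c + 26) * K) =
  L * K * (m2 / 2 + 1) * (1 + 2 * c) + 10 * c * (L * K) + 26 * (L * K) by ring.
by move: h1 h2; set z1 := _ * (1 + 2 * c); set z2 := _ * (1 + 2 * c); clear - LK L2; lra.
Qed.

Lemma dist_sum_pdist f t (x : R) : classF f ->
  pdist f (npow_it t) x ^+ 2 = dist_sum f t (Num.truncn x).
Proof.
move=> fF; rewrite /pdist sqr_sqrtr// sumr_ge0// => p pp.
rewrite divr_ge0// subr_ge0 (le_trans (ler_norm _))// (le_trans (normr_Re_le _))//.
rewrite normcM /npow_it -/(cis _) conj_cis normc_cis mulr1.
exact: classF_normc (prime_gt0 pp).
Qed.

Lemma log_sum_trivial f X : classF f -> normc (log_sum f X) <= 1 + ln X%:R.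
Proof.
move=> fF; apply: le_trans (@sum_inv_le R X).
rewrite (le_trans (normc_sum _ _ _))//; apply: ler_sum_nat => n /andP[n0 _].
exact: classF_term_le.
Qed.

Lemma log_sum_le f (x T : R) : classF f -> 2 <= x -> 0 < T -> T <= 1 ->
  normc (log_sum f (Num.truncn x)) <=
  halasz_const * (ln x * expR (- minM f x T) + 1 / T).
Proof.
move=> fF x2 T0 T1; set X := Num.truncn x.
have x0 : 0 <= x by lra.
have X1 : (0 < X)%N by rewrite /X truncn_ge_nat//; lra.
have Xx : X%:R <= x by rewrite truncn_le.
have lXx : ln X%:R <= ln x by rewrite ler_ln ?posrE ?ltr0n//; lra.
have h3 := halasz_const_ge3; set C := halasz_const in h3 *.
have Ti : 1 <= T^-1 by rewrite -[leRHS]div1r ler_pdivlMr// mul1r.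
have e0 := expR_gt0 (- minM f x T); have l0 := ln_nat_ge0 R X.
(* For bounded X the trivial bound suffices, because 1 / T >= 1. *)
rewrite div1r; have [L2|L2] := leP 2 (ln (X%:R : R)); last first.
  rewrite (le_trans (log_sum_trivial X fF))//.
  have : 0 <= ln x * expR (- minM f x T) by rewrite mulr_ge0// ?(ltW e0)// (le_trans l0).
  by move: L2; set l := ln X%:R; set y := ln x * _; clear - h3 Ti; nra.
have M0 : 0 <= ln X%:R * expR (- minM f x T) by rewrite mulr_ge0// ltW.
have T01 : 0 < T <= 1 by rewrite T0.
have hM t : `|t| <= T -> ln X%:R * expR (- dist_sum f t X) <= ln X%:R * expR (- minM f x T).
  move=> tT; rewrite ler_wpM2l// ler_expR lerN2 -dist_sum_pdist//.
  have [t0 [_ -> h]] := minM_attained f x (ltW T0); exact: h.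
rewrite (le_trans (log_sum_le_large L2 fF T01 M0 hM))// ler_wpM2l//; first exact: le_trans (ler0n _ 3) h3.
by rewrite lerD2r// ler_wpM2r// ltW.
Qed.
End LogarithmicMean.

Theorem theorem1p4 (R : realType) :
  exists C : R, 0 < C /\
    forall (f : nat -> R[i]) (x T : R),
      classF f -> 2 <= x -> 0 < T -> T <= 1 ->
      `|\sum_(1 <= n < (Num.truncn x).+1) f n / n%:R|
        <= (C * (ln x * expR (- minM f x T) + 1 / T))%:C.
Proof.
exists (halasz_const R); split; first by have := halasz_const_ge3 R; lra.
move=> f x T fF x2 T0 T1; rewrite normrC lecR.
apply: le_trans (log_sum_le fF x2 T0 T1); rewrite /log_sum le_eqVlt; apply/orP; left.
apply/eqP; congr (normc _); apply: eq_bigr => n _.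
by rewrite fmorphV /= rmorph_nat.
Qed.
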